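(* Let $\mathcal S_1\le\mathcal S_2\le\mathcal R$ be discrete, probability measure-preserving equivalence relations on a standard probability space $(X,\mu)$. Let $\nu\in\mathrm{Prob}([\mathcal R])$ be countably supported, symmetric, and generate $\mathcal R$. If $\mathcal S_1$ is everywhere coamenable in $\mathcal S_2$, then $\rho^{\mathcal S_1}_\nu=\rho^{\mathcal S_2}_\nu$ almost everywhere.
   Context: A discrete, probability measure-preserving (pmp) equivalence relation on $(X,\mu)$ is a Borel set $\mathcal R\subseteq X\times X$ which is an equivalence relation with countable classes $[x]_{\mathcal R}$ satisfying the mass transport principle $\int_X\sum_{y\in[x]_{\mathcal R}}f(x,y)\,d\mu(x)=\int_X\sum_{y\in[x]_{\mathcal R}}f(y,x)\,d\mu(x)$ for all Borel $f\colon\mathcal R\to[0,\infty]$. $\mathcal S\le\mathcal R$ means $\mathcal S$ is a Borel subset of $\mathcal R$ that is an equivalence relation on $X$. The full group $[\mathcal R]$ consists of the bimeasurable bijections $\gamma\colon X\to X$ with $\gamma(x)\in[x]_{\mathcal R}$ for a.e. $x$, modulo a.e. equality. For measurable $E$ with $\mu(E)>0$, $\mathcal R|_E=\mathcal R\cap(E\times E)$ is a discrete pmp relation on $(E,\mu(E\cap\cdot)/\mu(E))$. For $\mathcal S\le\mathcal R$: $[x]_{\mathcal R}/\mathcal S$ is the set of $\mathcal S$-classes contained in $[x]_{\mathcal R}$; $\mathcal R/\mathcal S=\{(x,c):x\in X,c\in[x]_{\mathcal R}/\mathcal S\}$, with the standard Borel structure in which $E$ is Borel iff $\{x:(x,[\gamma(x)]_{\mathcal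 S})\in E\}$ is Borel for every Borel $\gamma\in[\mathcal R]$, and with the measure $\mu_{\mathcal R/\mathcal S}(E)=\int_X|\{c:(x,c)\in E\}|\,d\mu(x)$. For $\xi\in L^2(\mathcal R/\mathcal S)$ put $\xi_x(c)=\xi(x,c)$, $\xi_x\in\ell^2([x]_{\mathcal R}/\mathcal S)$. $\mathcal S$ is coamenable in $\mathcal R$ if there is a sequence $\xi^{(n)}\in L^2(\mathcal R/\mathcal S)$ with $\|\xi^{(n)}_x\|_2=1$ for a.e. $x\in X$ and $\|\xi^{(n)}_x-\xi^{(n)}_y\|_2\to_{n\to\infty}0$ for $\mu_{\mathcal R}$-a.e. $(x,y)\in\mathcal R$, where $\mu_{\mathcal R}(E)=\int_X|\{y:(x,y)\in E\}|\,d\mu(x)$. $\mathcal S$ is everywhere coamenable in $\mathcal R$ if $\mathcal S|_E$ is coamenable in $\mathcal R|_E$ for every measurable $E\subseteq X$ with $\mu(E)>0$. (In the claim these notions are applied to the pair $\mathcal S_1\le\mathcal S_2$.) A countably supported $\nu\in\mathrm{Prob}([\mathcal R])$ is symmetric if $\nu(\{\gamma\})=\nu(\{\gamma^{-1}\})$ for all $\gamma$; it generates $\mathcal R$ if $\langle\mathrm{supp}(\nu)\rangle x=[x]_{\mathcal R}$ for a.e. $x$. For symmetric $\nu$, consider the random walk on $[x]_{\mathcal R}$ started at $x$ with transition probabilities $p_{y,z}=\nu(\{\gamma:\gamma(y)=z\})$, let $p_{k,x,\mathcal S}$ be the probability that it lies in $[x]_{\mathcal S}$ after $k$ steps, and $\rho^{\mathcal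 S}_\nu(x)=\lim_{k\to\infty}p_{2k,x,\mathcal S}^{1/2k}$, which exists for a.e. $x$ (a known theorem of Abért–Frączyk–Hayes). *)

(* Defs.v *)
From HB Require Import structures.
From mathcomp Require Import all_boot all_order all_algebra.
From mathcomp Require Import all_classical all_reals all_analysis.
From mathcomp Require Import measurable_realfun.
From mathcomp Require Import complex.

Set Implicit Arguments.
Unset Strict Implicit.
Unset Printing Implicit Defensive.

Import Order.TTheory GRing.Theory Num.Theory.
Import numFieldNormedType.Exports.
Import ComplexField.Normc.

Local Open Scope classical_set_scope.
Local Open Scope ring_scope.

(** [K] is the field of real numbers; a relation on [X] is a set of pairs, and
    the class of [x] under [R] is [xsection R x]. *)

(** The Borel structure of [X] is that of some Polish space [P]. A Hausdorff
    pseudometric is a metric. *)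
Definition standard_borel (K : realType) d (X : measurableType d) : Prop :=
  exists (P : completePseudoMetricType K) (f : X -> P),
    [/\ hausdorff_space P, @second_countable P, bijective f &
        forall A : set X, measurable A <-> <<s [set U : set P | open U] >> (f @` A)].

Section relations.
Context (K : realType) d (X : measurableType d).
Implicit Types (mu : {measure set X -> \bar K}) (E : set X) (R S : set (X * X)).

Definition equivalence_relation R : Prop :=
  [/\ forall x, R (x, x),
      forall x y, R (x, y) -> R (y, x) &
      forall x y z, R (x, y) -> R (y, z) -> R (x, z)].

Record discrete_pmp mu R : Prop := DiscretePmp {
  discrete_pmp_measurable : measurable R ;
  discrete_pmp_equivalence : equivalence_relation R ;
  discrete_pmp_countable : forall x, countable (xsection R x) ;
  discrete_pmp_mass_transport : forall f : X * X -> \bar K,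
    measurable_fun R f -> (forall p, R p -> (0 <= f p)%E) ->
    (\int[mu]_x (\esum_(y in xsection R x) f (x, y)) =
     \int[mu]_x (\esum_(y in xsection R x) f (y, x)))%E }.

Definition subrelation S R : Prop :=
  [/\ measurable S, equivalence_relation S & S `<=` R].

Definition restrict_rel E R : set (X * X) := R `&` (E `*` E).

(** In this section and the next, a probability space [E] that is a measurable
    part of [X] is given by [E] together with a measure [mu] on [X] carried by
    [E], and a relation on [E] is a set of pairs contained in [E `*` E]. *)

(** Genuine maps representing the elements of the full group; values outside
    [E] are irrelevant. *)
Definition full_group_map E mu R : set (X -> X) :=
  [set g | [/\ set_bij E E g,
               measurable_fun E g,
               forall A, measurable A -> A `<=` E -> measurable (g @` A) &
               {ae mu, forall x, E x -> R (x, g x)}]].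

(** [mu_R] *)
Definition rel_measure E mu R (N : set (X * X)) : \bar K :=
  (\int[mu]_(x in E) counting (xsection (N `&` R) x))%E.

End relations.

Section quotient.
Context (K : realType) d (X : measurableType d).
Variables (E : set X) (mu : {measure set X -> \bar K}) (R S : set (X * X)).

(** [[x]_R / S]; an [S]-class is a set of points. *)
Definition classes_in (x : X) : set (set X) := xsection S @` xsection R x.

(** The Borel structure of [R / S] is the trace on [quot_rel], defined
    below, of this one: for [A] contained in [R / S], the points where [g x] is
    not related to [x] do not contribute. *)
Definition quot_borel : set (set (X * set X)) :=
  [set A | forall g, full_group_map E mu R g ->
     measurable (E `&` [set x | A (x, xsection S (g x))])].

Lemma quot_borel_sigma_algebra : measurable E -> sigma_algebra setT quot_borel.
Proof.
move=> mE; split => [g _|A mA g gR|F mF g gR].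
- by rewrite (_ : _ `&` _ = set0)//; apply/seteqP; split => // x [].
- have -> : E `&` [set x | (setT `\` A) (x, xsection S (g x))] =
      E `\` (E `&` [set x | A (x, xsection S (g x))]).
    by apply/seteqP; split => x /= [Ex]; [case=> _ nA; split=> // -[]|tauto].
  by apply: measurableD => //; exact: mA.
- have -> : E `&` [set x | (\bigcup_n F n) (x, xsection S (g x))] =
      \bigcup_n (E `&` [set x | F n (x, xsection S (g x))]).
    by rewrite -setI_bigcupr.
  by apply: bigcupT_measurable => n; exact: mF.
Qed.

(** [R / S] *)
Definition quot_rel : set (g_sigma_algebraType quot_borel) :=
  [set p | E p.1 /\ classes_in p.1 p.2].

(** [mu_(R / S)] *)
Definition quot_measure (A : set (g_sigma_algebraType quot_borel)) : \bar K :=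
  (\int[mu]_(x in E) counting [set c | classes_in x c /\ A (x, c)])%E.

(** Complex-valued functions on [R / S]; values outside [quot_rel] are
    irrelevant. *)
Definition L2 (xi : g_sigma_algebraType quot_borel -> K[i]) : Prop :=
  [/\ measurable_fun quot_rel (fun q => complex.Re (xi q)),
      measurable_fun quot_rel (fun q => complex.Im (xi q)) &
      (\int[quot_measure]_(q in quot_rel) ((normc (xi q)) ^+ 2)%:E < +oo)%E].

Definition ell2_norm (C : set (set X)) (f : set X -> K[i]) : \bar K :=
  ((\esum_(c in C) ((normc (f c)) ^+ 2)%:E) `^ 2^-1)%E.

(** For [(x, y)] in [R], [classes_in x = classes_in y]. *)
Definition coamenable : Prop :=
  exists xi : nat -> X * set X -> K[i],
    [/\ forall n, L2 (xi n),
        forall n, {ae mu, forall x, E x ->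
          ell2_norm (classes_in x) (fun c => xi n (x, c)) = 1%E} &
        {ae rel_measure E mu R, forall p, R p ->
          ell2_norm (classes_in p.1) (fun c => xi n (p.1, c) - xi n (p.2, c))
            @[n --> \oo] --> 0%E}].

End quotient.

(** The measure [mnormalize (mrestr mu mE) mu] is [mu (_ `&` E) / mu E] when
    [mu E] is nonzero. *)
Definition everywhere_coamenable (K : realType) d (X : measurableType d)
    (mu : probability X K) (R S : set (X * X)) : Prop :=
  forall (E : set X) (mE : measurable E), (0 < mu E)%E ->
    coamenable E (mnormalize (mrestr mu mE) mu)
      (restrict_rel E R) (restrict_rel E S).

Section full_group.
Context (K : realType) d (X : measurableType d).
Variables (mu : {measure set X -> \bar K}) (R : set (X * X)).

Definition ae_class (g : X -> X) : set (X -> X) :=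
  [set h | full_group_map setT mu R h /\ {ae mu, forall x, h x = g x}].

(** [[R]], as a set of a.e.-equality classes *)
Definition full_group : set (set (X -> X)) :=
  ae_class @` full_group_map setT mu R.

Definition inv_class (c : set (X -> X)) : set (X -> X) :=
  [set h | exists2 g, c g & cancel g h /\ cancel h g].

End full_group.

(** The smallest group of bijections containing [G]. *)
Definition generated_group (T : Type) (G : set (T -> T)) : set (T -> T) :=
  smallest [set H | [/\ H id,
      forall g h, H g -> H h -> H (g \o h) &
      forall g h, H g -> cancel g h -> cancel h g -> H h]] G.

(** The set of a.e.-equality classes with its discrete Borel structure. *)
Notation fg_type X :=
  (g_sigma_algebraType (@discrete_measurable (set (X -> X)))).

Section random_walk.
Context (K : realType) d (X : measurableType d).
Variables (mu : {measure set X -> \bar K}) (R : set (X * X)).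
Variable nu : probability (fg_type X) K.

Definition countably_supported : Prop :=
  exists C : set (set (X -> X)),
    [/\ countable C, C `<=` full_group mu R & nu C = 1%E].

Definition symmetric_law : Prop :=
  forall c, full_group mu R c -> nu [set c] = nu [set inv_class c].

Definition law_support : set (set (X -> X)) :=
  [set c | full_group mu R c /\ nu [set c] <> 0%E].

(** The elements of the full group act on points only up to null sets: [rep]
    chooses a genuine map in each of them. *)
Variable rep : set (X -> X) -> X -> X.

Definition representatives : Prop := forall c, full_group mu R c -> c (rep c).

Definition generates : Prop :=
  {ae mu, forall x,
    [set g x | g in generated_group (rep @` law_support)] = xsection R x}.

Definition transition (y z : X) : \bar K := nu [set c | rep c y = z].

(** The law, on the class of [x], of the walk started at [x] after [k] steps *)
Fixpoint walk (k : nat) (x z : X) : \bar K :=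
  if k is k'.+1 then
    (\esum_(y in xsection R x) walk k' x y * transition y z)%E
  else (x == z)%:R%:E.

Definition return_prob (k : nat) (x : X) (S : set (X * X)) : \bar K :=
  (\esum_(y in xsection S x) walk k x y)%E.

(** [rho] is (a version of) the a.e. defined limit of the [p_(2k,x,S)^(1/2k)],
    which exists by a theorem of Abert, Fraczyk and Hayes; the term [k = 0] is a
    dummy. *)
Definition cospectral_radius (S : set (X * X)) (rho : X -> K) : Prop :=
  {ae mu, forall x,
    fine (return_prob (2 * k) x S) `^ (2 * k)%:R^-1 @[k --> \oo] --> rho x}.

End random_walk.

(* Main.v *)
Require Import Defs.
From HB Require Import structures.
From mathcomp Require Import all_boot all_order all_algebra finmap.
From mathcomp Require Import all_classical all_reals all_analysis.
From mathcomp Require Import measurable_realfun complex ring.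

(** Write [P_k] for the [k]-step transition kernel of the walk. Fix [r > 0] and
    let [E] be the set of [x] such that [sum_l r^(-2l) P_(2l)(x, [x]_S1)] is
    finite; it is enough to show that almost every point of [E] satisfies the
    same condition for [S2] and every larger radius. For an [S1]-class [c]
    meeting [E], the Green function
    [h(x, c) = sum_l r^(-2l) P_(2l + b)(x, c)], where [b] is 0 or 1, is a
    positive function of [x] with [P_(2k) h <= r^(2k) h]. By the Schur test,
    whose symmetrization step is the mass transport principle,
      [int sum_y P_(2k)(x, y) <eta_x, eta_y> dmu(x) <= r^(2k) int |eta_x|^2 dmu(x)]
    for all nonnegative fields [eta_x] of functions of such classes. Apply this
    to [eta^n_x = |xi^n_(theta x)|], where [xi^n] are the almost invariant vectors
    witnessing the coamenability of [S1] in [S2] on [E] and [theta] retracts the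
    [S2]-saturation [F] of [E] onto [E] inside the [S2]-classes. Since
    [<eta^n_x, eta^n_y>] tends to 1 when [x] and [y] are [S2]-related, Fatou's
    lemma gives [int_F P_(2k)(x, [x]_S2) dmu(x) <= r^(2k)] for all [k]. *)

Set Implicit Arguments.
Unset Strict Implicit.
Unset Printing Implicit Defensive.

Import Order.TTheory GRing.Theory Num.Theory.
Import numFieldNormedType.Exports.

Local Open Scope classical_set_scope.
Local Open Scope ring_scope.
Local Open Scope ereal_scope.

(** * Sums and integrals of nonnegative functions *)

(** The Schur weights [h(x, c)] make sense only for classes [c] along which the Green function is
    finite. The almost invariant vectors must therefore live on the classes meeting [E], and this is
    what coamenability of the pair restricted to [E] provides. Generation then spreads positivity
    and finiteness of [h(_, c)] from a point of [E] to the whole [R]-class. Only the ratios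
    [h(y, c) / h(x, c)] enter the estimate, so no normalization of [h] has to be chosen. A second
    obstacle is that inverses, generation and almost invariance hold only up to null sets, while the
    Green function involves whole orbits. Everything is therefore done pointwise on a conull Borel
    [R]-invariant set [D], on which the words in the support of [nu] enumerate the classes. The same
    enumeration reduces all measurability questions to functions of one variable. The loss from [r]
    to a larger radius [r'] comes from summing the bounds [r^(2k)] against [r'^(-2k)]; it disappears
    because [r] and [r'] can be rationals strictly between the two radii. *)

Section esum_lemmas.
Context (K : realType).
Implicit Types (T : choiceType).

Lemma le_esum_term T (I : set T) (a : T -> \bar K) i :
  (forall j, I j -> 0 <= a j) -> I i -> a i <= \esum_(j in I) a j.
Proof.
move=> a0 Ii; rewrite -(@esum_set1 _ _ i)//; last exact: a0.
rewrite esum_mkcond [leRHS]esum_mkcond; apply: le_esum => j _.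
case: ifPn => [|_]; first by rewrite inE => ->; rewrite mem_set.
by case: ifPn => // /[!inE] /a0.
Qed.

Lemma le_esum_subset T (I J : set T) (a : T -> \bar K) :
  (forall j, J j -> 0 <= a j) -> I `<=` J ->
  \esum_(j in I) a j <= \esum_(j in J) a j.
Proof.
move=> a0 IJ; rewrite esum_mkcond [leRHS]esum_mkcond; apply: le_esum => j _.
case: ifPn => [|_]; first by rewrite inE => /IJ Jj; rewrite mem_set.
by case: ifPn => // /[!inE] /a0.
Qed.

(** Finite subsums give one inequality for every factor. Applied to the inverse factor it gives the
    other one; the factors [+oo] and 0 are treated apart. *)
Lemma esumZl T (I : set T) (a : T -> \bar K) (c : \bar K) :
  0 <= c -> (forall i, I i -> 0 <= a i) ->
  \esum_(i in I) (c * a i) = c * \esum_(i in I) a i.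
Proof.
have half (b : T -> \bar K) (e : \bar K) : 0 <= e -> (forall i, I i -> 0 <= b i) ->
    \esum_(i in I) (e * b i) <= e * \esum_(i in I) b i.
  move=> e0 b0; apply: ge_ereal_sup => /= _ [Y [finY YI]] <-.
  rewrite fsbig_finite//= big_seq -ge0_sume_distrr; last first.
    by move=> i; rewrite in_fset_set// inE => /YI/b0.
  rewrite -big_seq lee_wpmul2l// -fsbig_finite//; apply: ereal_sup_ubound.
  by exists Y.
move=> c0 a0; apply/eqP; rewrite eq_le half//=.
case: c c0 => [r| |//]; rewrite ?lee_fin => r0; last first.
  have [[i [Ii ai]]|no] := pselect (exists i, I i /\ 0 < a i).
    rewrite [leRHS](_ : _ = +oo) ?leey//; apply/eqP; rewrite -leye_eq.
    rewrite (le_trans _ (@le_esum_term _ _ _ i _ _))// ?gt0_mulye//.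
    by move=> j /a0 aj; exact: mule_ge0.
  rewrite (@esum1 _ _ _ a) ?mule0 ?esum_ge0// => i Ii; first exact/mule_ge0/a0.
  apply/eqP; rewrite eq_le a0// andbT leNgt; apply/negP => ai; apply: no.
  by exists i.
have [->|rn0] := eqVneq r 0%R.
  by rewrite mul0e esum_ge0// => i Ii; rewrite mul0e.
have rp : (0 < r)%R by rewrite lt_neqAle eq_sym rn0.
rewrite -lee_pdivlMl//.
rewrite (le_trans _ (half _ _ _ _)) ?lee_fin ?invr_ge0//; last first.
  by move=> i Ii; apply: mule_ge0 => //; exact: a0.
by apply: le_esum => i Ii; rewrite muleA -EFinM mulVf// mul1e.
Qed.

Lemma esumZr T (I : set T) (a : T -> \bar K) (c : \bar K) :
  0 <= c -> (forall i, I i -> 0 <= a i) ->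
  \esum_(i in I) (a i * c) = (\esum_(i in I) a i) * c.
Proof.
by move=> c0 a0; rewrite muleC -esumZl//; apply: eq_esum => i _; rewrite muleC.
Qed.

Lemma exchange_esum (T1 T2 : choiceType) (I : set T1) (J : set T2)
    (a : T1 -> T2 -> \bar K) : (forall i j, I i -> J j -> 0 <= a i j) ->
  \esum_(i in I) \esum_(j in J) a i j = \esum_(j in J) \esum_(i in I) a i j.
Proof.
move=> a0; rewrite !esum_esum//; last by move=> j i Jj Ii; exact: a0.
rewrite (reindex_esum (J `*`` (fun=> I)) _ (fun x => (x.2, x.1)))//; split => /=.
- by move=> [i j] [/=].
- by move=> [i1 i2] [j1 j2] /= _ _ [] -> ->.
- by move=> [i j] [Ii Jj] /=; exists (j, i).
Qed.

(** The enumeration [f] may repeat values, so each value is counted at its first index in [J]. This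
    turns a sum over a countable class into a series indexed by [nat], whose terms can be checked to
    be measurable. *)
Lemma esum_first_index T (f : nat -> T) (J : set nat) (a : T -> \bar K) :
  (forall i, J i -> 0 <= a (f i)) ->
  \esum_(y in f @` J) a y =
  \sum_(0 <= i <oo)
    if `[< J i /\ forall j, (j < i)%N -> J j -> f j <> f i >] then a (f i) else 0.
Proof.
move=> a0; pose L := [set i | J i /\ forall j, (j < i)%N -> J j -> f j <> f i].
have -> : f @` J = f @` L.
  apply/seteqP; split => [_ [i Ji <-]|_ [i [Ji _] <-]]; last by exists i.
  have ex : exists j, `[< J j /\ f j = f i >] by exists i; exact/asboolP.
  case: (ex_minnP ex) => m /asboolP[Jm fm] mmin; exists m => //; split => // j jm.
  move=> Jj fj; have /mmin : `[< J j /\ f j = f i >].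
    by apply/asboolP; rewrite fj.
  by rewrite leqNgt jm.
rewrite esum_image; last first.
  move=> i j /[!inE] -[Ji Li] [Jj Lj] fij.
  case: (ltngtP i j) => // ij; first by have := Lj _ ij Ji fij.
  by have := Li _ ij Jj (esym fij).
rewrite esum_mkcond nneseries_esumT; last first.
  by move=> i; case: ifPn => // /asboolP[Ji _]; exact: a0.
apply: eq_esum => i _; congr (if _ then _ else _).
Qed.

End esum_lemmas.

Section lower_integral.
Import HBNNSimple.
Context (K : realType) d (X : measurableType d) (mu : {measure set X -> \bar K}).

(* The library's integral of a nonnegative function is a supremum over simple
   functions below it, so monotonicity needs no measurability. *)
Lemma le_lower_integral (D : set X) (f g : X -> \bar K) :
  (forall x, D x -> 0 <= f x) -> (forall x, D x -> f x <= g x) ->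
  \int[mu]_(x in D) f x <= \int[mu]_(x in D) g x.
Proof.
move=> f0 fg; rewrite integral_mkcond [leRHS]integral_mkcond.
have f0' x : 0 <= (f \_ D) x by apply: erestrict_ge0.
have fg' x : (f \_ D) x <= (g \_ D) x by apply: lee_restrict.
rewrite !ge0_integralTE//; last by move=> x; exact: le_trans (fg' x).
apply: ge_ereal_sup => _ [h hf <-]; apply: ereal_sup_ubound.
by exists h => // x; exact: le_trans (fg' x).
Qed.

(** No measurability of [f] is assumed: [f] lies below the function equal to [+oo] on [N] and to 0
    elsewhere. *)
Lemma lower_integral_null (D N : set X) (f : X -> \bar K) :
  measurable N -> mu N = 0 -> (forall x, D x -> 0 <= f x) ->
  (forall x, D x -> ~ N x -> f x = 0) -> \int[mu]_(x in D) f x = 0.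
Proof.
move=> mN N0 f0 fN; apply/eqP; rewrite eq_le integral_ge0// andbT.
rewrite integral_mkcond.
apply: (@le_trans _ _ (\int[mu]_(x in setT) ((cst +oo) \_ N) x)).
  apply: le_lower_integral => x _; first exact: erestrict_ge0.
  rewrite !patchE; case: ifPn => [|_]; last by case: ifPn; rewrite ?leey.
  rewrite inE => Dx; case: ifPn => [_|]; first by rewrite leey.
  by rewrite notin_setE => /(fN _ Dx) ->.
by rewrite -integral_mkcond integral_cst// N0 mule0.
Qed.

End lower_integral.

(** * Mass transport *)

Lemma countable_enum (T : choiceType) (A : set T) (a : T) :
  A a -> countable A -> exists e : nat -> T, range e = A.
Proof.
move=> Aa /countable_injP[f finj].
exists (fun n => xget a [set x | A x /\ f x = n]).
apply/seteqP; split => [_ [n _ <-]|x Ax]; first by case: xgetP => [y _ []|].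
exists (f x) => //; case: xgetP => [y _ [Ay fyx]|/(_ x)]; last by case.
by apply: finj; rewrite ?inE.
Qed.

(** The form in which standardness of [X] enters: a countable separating family makes coincidence
    sets and graphs of Borel maps measurable. *)
Definition separating d (X : measurableType d) (B : nat -> set X) :=
  (forall n, measurable (B n)) /\
  (forall x y, x <> y -> exists n, B n x /\ ~ B n y).

Lemma standard_borel_separating (K : realType) d (X : measurableType d) :
  standard_borel K X -> exists B, @separating d X B.
Proof.
case=> P [f [hP [W cW [Wopen Wbasis]] bijf mP]].
have injf : injective f by exact: bij_inj.
have [W0|/set0P[U WU]] := eqVneq W set0; last first.
  have [e eW] := countable_enum WU cW.
  have We n : W (e n) by rewrite -eW; exists n.
  exists (fun n => f @^-1` e n); split => [n|x y xy].
    apply/mP; rewrite image_preimage; first by apply: sub_sigma_algebra; exact: Wopen.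
    apply/seteqP; split => // p _; have [g _ gK] := bijf.
    by exists (g p).
  have fxy : f x != f y by apply/eqP => /injf.
  have := hP; rewrite open_hausdorff => /(_ _ _ fxy)[[A1 A2]] /=.
  move=> [/[!inE] A1x A2y] [oA1 oA2 A12].
  have /Wbasis[V [WV Vx] VA1] : nbhs (f x) A1 by exact: open_nbhs_nbhs.
  move: WV; rewrite -eW => -[n _ enV]; exists n; rewrite /preimage/= enV.
  split => // /VA1 A1y.
  by have : (A1 `&` A2) (f y) by []; rewrite A12.
(* A space with an empty base has no points. *)
exists (fun _ => set0); split => // x y _.
have /Wbasis[V [WV _] _] : nbhs (f x) setT by exact: filterT.
by rewrite W0 in WV.
Qed.

Section measurability.
Context (K : realType) d (X : measurableType d) (B : nat -> set X).
Hypothesis sepB : separating B.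

Lemma measurable_eq_set d' (T : measurableType d') (f g : T -> X) :
  measurable_fun setT f -> measurable_fun setT g ->
  measurable [set t | f t = g t].
Proof.
move=> mf mg; have [mB sB] := sepB.
rewrite (_ : [set t | f t = g t] =
    ~` \bigcup_n (f @^-1` B n `&` ~` (g @^-1` B n))).
  apply: measurableC; apply: bigcupT_measurable => n; apply: measurableI.
    by rewrite -[X in measurable X]setTI; exact: mf.
  by apply: measurableC; rewrite -[X in measurable X]setTI; exact: mg.
apply/seteqP; split => [t /= fg [n _ [/= +]]|t /= H]; first by rewrite fg.
by apply: contrapT => /sB[n [Bf Bg]]; apply: H; exists n.
Qed.

Lemma measurable_fun_ifprop_in d' (T : measurableType d') (D : set T)
    (Q : T -> Prop) (f : T -> \bar K) :
  measurable (D `&` [set t | Q t]) -> measurable_fun (D `&` [set t | Q t]) f ->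
  measurable_fun D (fun t => if `[< Q t >] then f t else 0).
Proof.
have QE : (fun t => `[< Q t >]) @^-1` [set true] = [set t | Q t].
  by apply/seteqP; split => t /= /asboolP.
move=> mQ mf mD; apply: measurable_fun_if => //; last by rewrite QE.
by apply: (@measurable_fun_bool _ _ _ _ true); rewrite QE.
Qed.

Lemma measurable_fun_ifprop d' (T : measurableType d') (D : set T)
    (Q : T -> Prop) (f : T -> \bar K) :
  measurable (D `&` [set t | Q t]) -> measurable_fun D f ->
  measurable_fun D (fun t => if `[< Q t >] then f t else 0).
Proof.
move=> mQ mf mD; apply: measurable_fun_ifprop_in => //.
by apply: measurable_funS mf => // t [].
Qed.

Lemma measurable_nneseries d' (T : measurableType d') (D : set T)
    (f : nat -> T -> \bar K) :
  (forall i t, D t -> 0 <= f i t) -> (forall i, measurable_fun D (f i)) ->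
  measurable_fun D (fun t => \sum_(0 <= i <oo) f i t).
Proof.
move=> f0 mf; apply: (@emeasurable_fun_cvg _ _ _ _
  (fun n t => \sum_(0 <= i < n) f i t)) => [n|t Dt].
  exact: emeasurable_sum.
by apply: is_cvg_nneseries => i _ _; exact: f0.
Qed.

End measurability.

(** Plays the role of a Lusin-Novikov enumeration of the classes. The maps [g i] are Borel on all of
    [X] but enumerate the classes, possibly with repetitions, only over the invariant set [D]. *)
Record enumerated (d : measure_display) (X : measurableType d)
    (R : set (X * X)) (D : set X) (g : nat -> X -> X) : Prop := Enumerated {
  enum_measurable : measurable D ;
  enum_equivalence : equivalence_relation R ;
  enum_invariant : forall x y, D x -> R (x, y) -> D y ;
  enum_fun : forall i, measurable_fun setT (g i) ;
  enum_orbit : forall x, D x -> xsection R x = range (g ^~ x) }.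

Section mass_transport.
Context (K : realType) d (X : measurableType d) (B : nat -> set X)
  (mu : probability X K) (R : set (X * X)).
Hypotheses (sepB : separating B) (hR : discrete_pmp mu R).

(** The mass transport principle for functions that are only known to be measurable along the graphs
    of the [g i]. These graphs cover the part of [R] over [D], and extension by 0 gives a measurable
    function on [R]. *)
Lemma enumerated_mass_transport (D : set X) (g : nat -> X -> X)
    (F : X -> X -> \bar K) : enumerated R D g ->
  (forall i, measurable_fun D (fun x => F x (g i x))) ->
  (forall x y, D x -> R (x, y) -> 0 <= F x y) ->
  \int[mu]_(x in D) (\esum_(y in xsection R x) F x y) =
  \int[mu]_(x in D) (\esum_(y in xsection R x) F y x).
Proof.
move=> [mD [_ Rsym _] Dinv mg orb] mF F0.
pose f p := if `[< D p.1 >] then F p.1 p.2 else 0.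
have mR := discrete_pmp_measurable hR.
have mf : measurable_fun R f.
  move=> _ Y mY; pose A i := D `&` (fun x => F x (g i x)) @^-1` Y.
  have mA i : measurable (A i) by exact: mF.
  (* Over [D] the preimage is cut along the graphs of the [g i]; off [D] the value is 0, so
     everything or nothing is kept there. *)
  rewrite (_ : R `&` f @^-1` Y =
    (R `&` \bigcup_i (fst @^-1` A i `&` [set p | p.2 = g i p.1])) `|`
    (if `[< Y 0 >] then R `&` fst @^-1` (~` D) else set0)).
    apply: measurableU.
      apply: measurableI => //; apply: bigcupT_measurable => i.
      apply: measurableI; last first.
        apply: (measurable_eq_set sepB); first exact: measurable_snd.
        exact: measurableT_comp.
      by rewrite -[X in measurable X]setTI; exact: measurable_fst.
    case: ifPn => // _; apply: measurableI => //.
    rewrite -[X in measurable X]setTI; apply: measurable_fst => //.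
    exact: measurableC.
  apply/seteqP; split => [[x y] /= [Rxy]|[x y]].
    rewrite /preimage/= /f/=; case: ifPn => [/asboolP Dx Yf|/asboolP Dx Y0].
      left; split => //; have : xsection R x y by exact/xsectionP.
      by rewrite orb// => -[i _ gi]; exists i => //=; split; rewrite /A/= ?gi.
    by right; rewrite ifT//; exact/asboolP.
  case=> [[Rxy [i _ [[/= Dx Yf] /= gi]]]|].
    by split => //; rewrite /f/preimage/= ifT ?gi//; exact/asboolP.
  case: ifPn => // /asboolP Y0 [Rxy /= Dx]; split => //.
  by rewrite /f/preimage/= ifF//; exact/asboolPn.
have f0 p : R p -> 0 <= f p.
  by case: p => x y Rxy; rewrite /f; case: ifPn => //= /asboolP Dx; exact: F0.
rewrite integral_mkcond [RHS]integral_mkcond.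
transitivity (\int[mu]_x (\esum_(y in xsection R x) f (x, y))).
  apply: eq_integral => x _; rewrite patchE; case: ifPn.
    by rewrite inE => Dx; apply: eq_esum => y _; rewrite /f/= ifT//; exact/asboolP.
  rewrite notin_setE => Dx; rewrite esum1// => y _.
  by rewrite /f/= ifF//; exact/asboolPn.
rewrite (discrete_pmp_mass_transport hR mf f0).
apply: eq_integral => x _; rewrite patchE; case: ifPn.
  rewrite inE => Dx; apply: eq_esum => y /xsectionP Rxy.
  by rewrite /f/= ifT//; apply/asboolP; exact: Dinv Rxy.
rewrite notin_setE => Dx; rewrite esum1// => y /xsectionP Rxy.
rewrite /f/= ifF//; apply/asboolPn => Dy.
by apply: Dx; apply: Dinv Dy _; exact: Rsym.
Qed.

(* The points of [N] sent out of [N] are negligible by mass transport along the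
   graph of [g i]. *)
Lemma enumerated_avoid_null (N : set X) (g : nat -> X -> X) :
  measurable N -> mu N = 0 -> (forall i, measurable_fun setT (g i)) ->
  (forall x, ~ N x -> xsection R x = range (g ^~ x)) ->
  exists2 D, enumerated R D g & [/\ mu (~` D) = 0 & D `<=` ~` N].
Proof.
move=> mN N0 mg orb; have [mR [Rr Rs Rt] _ mt] := hR.
have mgN i : measurable (g i @^-1` N).
  by rewrite -[X in measurable X]setTI; exact: mg.
(* Points outside [N] whose whole orbit avoids [N]; this makes [D] invariant. *)
pose D := ~` N `&` ~` \bigcup_i (g i @^-1` N).
have mD : measurable D.
  by apply: measurableI; apply: measurableC => //; exact: bigcupT_measurable.
have orbin x i : ~ N x -> R (x, g i x).
  by move=> Nx; apply/xsectionP; rewrite orb//; exists i.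
exists D; first split => //.
- move=> x y [Nx Ngx] Rxy.
  have Ny : ~ N y.
    have : xsection R x y by exact/xsectionP.
    by rewrite orb// => -[i _ <-] Ni; apply: Ngx; exists i.
  split => // -[j _ /= Nj]; have : xsection R x (g j y).
    by apply/xsectionP; apply: Rt Rxy _; exact: orbin.
  by rewrite orb// => -[i _ gi]; apply: Ngx; exists i => //=; rewrite gi.
- by move=> x [Nx _]; exact: orb.
split; last by move=> x [].
have gi0 i : mu (~` N `&` g i @^-1` N) = 0.
  pose A := ~` N `&` g i @^-1` N.
  have mA : measurable A by apply: measurableI => //; exact: measurableC.
  pose f p : \bar K := if `[< A p.1 /\ p.2 = g i p.1 >] then 1 else 0.
  have mf : measurable_fun R f.
    apply: (@measurable_fun_ifprop K _ _ _ (fun p => A p.1 /\ p.2 = g i p.1)).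
      apply: measurableI => //; apply: measurableI.
        by rewrite -[X in measurable X]setTI; exact: measurable_fst.
      apply: (measurable_eq_set sepB); first exact: measurable_snd.
      exact: measurableT_comp.
    exact: measurable_cst.
  have f0 p : 0 <= f p by rewrite /f; case: ifPn.
  have := mt f mf (fun p _ => f0 p).
  rewrite [RHS](@lower_integral_null _ _ _ _ _ N)//; first last.
  - move=> x _ Nx; apply: esum1 => y _; rewrite /f; case: ifPn => //=.
    by move=> /asboolP[[_ /= Ny] xE]; rewrite xE in Nx.
  - by move=> x _; apply: esum_ge0.
  move=> int0; apply/eqP; rewrite -measure_le0 -int0.
  apply: (@le_trans _ _ (\int[mu]_x (\1_A x)%:E)).
    by rewrite integral_indic// setIT.
  apply: le_lower_integral => x _.
    by rewrite lee_fin.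
  rewrite indicE; case: (boolP (x \in A)) => [|_]; last exact: esum_ge0.
  rewrite inE => Ax; rewrite (le_trans _ (@le_esum_term _ _ _ _ (g i x) _ _))//.
    by rewrite /f ifT//; exact/asboolP.
  by apply/xsectionP/orbin; case: Ax.
apply/eqP; rewrite -measure_le0.
have -> : ~` D = N `|` \bigcup_i (~` N `&` g i @^-1` N).
  rewrite /D setCI !setCK -setI_bigcupr setUIr setUv setTI//.
have mU : measurable (\bigcup_i (~` N `&` g i @^-1` N)).
  by apply: bigcupT_measurable => i; apply: measurableI => //; exact: measurableC.
have U0 : mu (\bigcup_i (~` N `&` g i @^-1` N)) = 0.
  apply/negligibleP => //; apply: negligible_bigcup => i.
  apply/negligibleP; last exact: gi0.
  by apply: measurableI => //; exact: measurableC.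
apply: (le_trans (measureU2 _ _ _)) => //.
by rewrite [X in X + _]N0 [X in _ + X]U0 adde0.
Qed.

End mass_transport.

(** * Green functions of the walk *)

Lemma xsection_equiv (T : Type) (Q : set (T * T)) x y :
  (forall x y, Q (x, y) -> Q (y, x)) ->
  (forall x y z, Q (x, y) -> Q (y, z) -> Q (x, z)) ->
  Q (x, y) -> xsection Q x = xsection Q y.
Proof.
move=> Qs Qt Qxy; apply/seteqP; split => z /xsectionP Qz; apply/xsectionP.
  by apply: Qt Qz; exact: Qs.
exact: Qt Qxy Qz.
Qed.

Section walk.
Context (K : realType) d (X : measurableType d) (R S : set (X * X))
  (nu : probability (fg_type X) K) (rep : set (X -> X) -> X -> X) (D : set X).
Hypotheses (eqR : equivalence_relation R) (eqS : equivalence_relation S)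
  (SR : S `<=` R).
Hypothesis Dinv : forall x y, D x -> R (x, y) -> D y.
Local Notation p := (transition nu rep).
Local Notation W := (walk R nu rep).
Hypothesis p_sym : forall x y, D x -> R (x, y) -> p x y = p y x.
Hypothesis p_le1 : forall x, D x -> \esum_(y in xsection R x) p x y <= 1.

Let Rr : forall x, R (x, x). Proof. by case: eqR. Qed.
Let Rs : forall x y, R (x, y) -> R (y, x). Proof. by case: eqR. Qed.
Let Rt : forall x y z, R (x, y) -> R (y, z) -> R (x, z).
Proof. by case: eqR. Qed.
Let Rclass x y : R (x, y) -> xsection R x = xsection R y.
Proof. exact: xsection_equiv. Qed.

Lemma transition_ge0 x y : 0 <= p x y.
Proof. exact: measure_ge0. Qed.

Lemma walk_ge0 k x y : 0 <= W k x y.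
Proof.
elim: k y => [y|k IH y] /=; first by rewrite lee_fin ler0n.
by apply: esum_ge0 => z _; rewrite mule_ge0 ?transition_ge0.
Qed.

Lemma esum_walk0 (a : X -> \bar K) x : (forall y, 0 <= a y) ->
  \esum_(y in xsection R x) W 0 x y * a y = a x.
Proof.
move=> a0; rewrite -[RHS](@esum_set1 _ _ x)//.
rewrite esum_mkcond [RHS]esum_mkcond; apply: eq_esum => y _ /=.
have [<-|xy] := eqVneq x y; last first.
  rewrite mul0e if_same ifF//; apply/negbTE; rewrite notin_setE => /esym/eqP.
  by rewrite (negbTE xy).
by rewrite mul1e !ifT// inE//; exact/xsectionP.
Qed.

Lemma walk1 x z : W 1 x z = p x z.
Proof.
by rewrite -[RHS](@esum_walk0 (fun y => p y z))// => y; exact: transition_ge0.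
Qed.

(** The Chapman-Kolmogorov equation. *)
Lemma walk_add k l x z : R (x, z) ->
  W (k + l) x z = \esum_(y in xsection R x) W k x y * W l y z.
Proof.
elim: l z => [z Rxz|l IH z Rxz].
  rewrite addn0 /= -[LHS](@esum_set1 _ _ z (W k x)) ?walk_ge0//.
  rewrite esum_mkcond [RHS]esum_mkcond; apply: eq_esum => y _ /=.
  have [->|xy] := eqVneq y z; last first.
    rewrite mule0 if_same ifF//; apply/negbTE; rewrite notin_setE => /eqP.
    by rewrite (negbTE xy).
  by rewrite mule1 !ifT// inE//; exact/xsectionP.
rewrite addnS /=.
transitivity (\esum_(y in xsection R x) \esum_(w in xsection R x)
    W k x w * W l w y * p y z).
  apply: eq_esum => y /xsectionP Rxy; rewrite IH//.
  rewrite esumZr ?transition_ge0// => w _.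
  by rewrite mule_ge0 ?walk_ge0.
rewrite exchange_esum; last first.
  by move=> y w _ _; rewrite !mule_ge0 ?walk_ge0 ?transition_ge0.
apply: eq_esum => w /xsectionP Rxw; rewrite -(Rclass Rxw) -esumZl ?walk_ge0//.
  by apply: eq_esum => y _; rewrite muleA.
by move=> y _; rewrite mule_ge0 ?walk_ge0 ?transition_ge0.
Qed.

(** The induction takes the last step off the walk from [x] and, by [walk_add], the first step off
    the walk from [y]. *)
Lemma walk_sym k x y : D x -> R (x, y) -> W k x y = W k y x.
Proof.
elim: k x y => [x y _ _|k IH x y Dx Rxy] /=; first by rewrite eq_sym.
rewrite -[RHS]/(W k.+1 y x) -add1n walk_add; last exact: Rs.
rewrite -(Rclass Rxy); apply: eq_esum => z /xsectionP Rxz.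
rewrite walk1 muleC; congr (_ * _); last exact: IH.
by apply: p_sym; [exact: Dinv Dx Rxz|apply: Rt Rxy; exact: Rs].
Qed.

Lemma walk_le1 k x : D x -> \esum_(y in xsection R x) W k x y <= 1.
Proof.
move=> Dx; elim: k => [|k IH].
  under eq_esum do rewrite -[W 0 _ _]mule1.
  by rewrite (@esum_walk0 (cst 1)).
rewrite /= exchange_esum; last first.
  by move=> y w _ _; rewrite !mule_ge0 ?walk_ge0 ?transition_ge0.
apply: le_trans IH; apply: le_esum => y /xsectionP Rxy.
rewrite esumZl ?walk_ge0//.
rewrite -[leRHS]mule1 lee_wpmul2l ?walk_ge0// (Rclass Rxy).
by apply: p_le1; exact: Dinv Rxy.
Qed.

Lemma walk_fin k x y : D x -> R (x, y) -> W k x y \is a fin_num.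
Proof.
move=> Dx Rxy; rewrite ge0_fin_numE ?walk_ge0//.
apply: le_lt_trans (ltry 1); apply: le_trans (walk_le1 k Dx).
by apply: le_esum_term; [move=> z _; exact: walk_ge0|exact/xsectionP].
Qed.

(* [hit k x x] is [return_prob R nu rep k x S]. *)
Definition hit k x z : \bar K := \esum_(y in xsection S z) W k x y.

Lemma hit_ge0 k x z : 0 <= hit k x z.
Proof. by apply: esum_ge0 => y _; exact: walk_ge0. Qed.

Lemma hit_class k x z z' : S (z, z') -> hit k x z = hit k x z'.
Proof.
by move=> Szz'; rewrite /hit (@xsection_equiv _ S z z')//; case: eqS.
Qed.

Lemma hit_add k l x z : R (x, z) ->
  hit (k + l) x z = \esum_(y in xsection R x) W k x y * hit l y z.
Proof.
move=> Rxz; rewrite /hit.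
transitivity (\esum_(y in xsection R x) \esum_(w in xsection S z)
    W k x y * W l y w); last first.
  apply: eq_esum => y _; rewrite esumZl ?walk_ge0// => w _; exact: walk_ge0.
rewrite exchange_esum; last by move=> y w _ _; rewrite mule_ge0 ?walk_ge0.
apply: eq_esum => y /xsectionP/SR Rzy; apply: walk_add; exact: Rt Rzy.
Qed.

Context (r : K).
Hypothesis r0 : (0 < r)%R.

Definition green b x z : \bar K :=
  \esum_(l in [set: nat]) (r ^- (2 * l))%:E * hit (2 * l + b) x z.

Let c_ge0 l : 0 <= (r ^- (2 * l))%:E.
Proof. by rewrite lee_fin invr_ge0 exprn_ge0// ltW. Qed.

Lemma green_ge0 b x z : 0 <= green b x z.
Proof. by apply: esum_ge0 => l _; rewrite mule_ge0// hit_ge0. Qed.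

(** Shifting the index by [m] costs the factor [r ^+ (2 * m)]; the inequality comes from the [m]
    initial terms that the shifted series omits. *)
Lemma green_shift m b x z :
  \esum_(l in [set: nat]) (r ^- (2 * l))%:E * hit (2 * (l + m) + b) x z <=
  (r ^+ (2 * m))%:E * green b x z.
Proof.
have rm0 : (0 < r ^+ (2 * m))%R by exact: exprn_gt0.
have rm0' : 0 <= (r ^+ (2 * m))%:E by rewrite lee_fin ltW.
rewrite -esumZl//; last by move=> l _; rewrite mule_ge0// hit_ge0.
apply: (@le_trans _ _ (\esum_(l in (addn^~ m) @` [set: nat])
    (r ^+ (2 * m))%:E * ((r ^- (2 * l))%:E * hit (2 * l + b) x z))).
  rewrite esum_image; last by move=> i j _ _ /addIn.
  apply: le_esum => l _; rewrite muleA -EFinM mulnDr exprD invfM mulrCA.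
  by rewrite mulfV ?mulr1// gt_eqF.
apply: le_esum_subset => // l _.
by rewrite !mule_ge0 ?hit_ge0.
Qed.

(** Averaging over [2 * k] steps replaces [hit (2 * l + b)] by [hit (2 * (l + k) + b)], and the
    shift is paid for by [green_shift]. *)
Lemma green_superharmonic k b x z : R (x, z) ->
  \esum_(y in xsection R x) W (2 * k) x y * green b y z <=
  (r ^+ (2 * k))%:E * green b x z.
Proof.
move=> Rxz; apply: le_trans (green_shift k b x z).
apply: (@le_trans _ _ (\esum_(y in xsection R x) \esum_(l in [set: nat])
    W (2 * k) x y * ((r ^- (2 * l))%:E * hit (2 * l + b) y z))).
  apply: le_esum => y _; rewrite esumZl ?walk_ge0// => l _.
  by rewrite mule_ge0// hit_ge0.
rewrite exchange_esum; last by move=> y l _ _; rewrite !mule_ge0 ?walk_ge0 ?hit_ge0.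
apply: le_esum => l _.
under eq_esum do rewrite muleCA.
rewrite esumZl//; last by move=> y _; rewrite mule_ge0 ?walk_ge0 ?hit_ge0.
by rewrite -hit_add// mulnDr addnAC addnC addnA.
Qed.

Definition pos_finite (h : \bar K) := 0 < h /\ h < +oo.

(* Paths from [x] to the class of [z] may all have odd length, and then the even
   Green function vanishes; the two cases do not mix under an even number of
   steps. *)
Definition weight x z : K :=
  fine (if `[< pos_finite (green 0 x z) >] then green 0 x z else green 1 x z).

Lemma weight_class x z z' : S (z, z') -> weight x z = weight x z'.
Proof.
move=> Szz'; have hz k y := hit_class k y Szz'.
have gE b : green b x z = green b x z' by apply: eq_esum => l _; rewrite hz.
by rewrite /weight !gE.
Qed.

Lemma weight_ge0 x z : (0 <= weight x z)%R.
Proof. by rewrite fine_ge0//; case: ifPn => _; exact: green_ge0. Qed.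

(** A Harnack argument. A single term of the superharmonic inequality at [x] shows that the value at
    [y] is finite; the same inequality at [y], with the walk reversed by symmetry, shows that it is
    nonzero. *)
Lemma green_step k b x y z : D x -> R (x, y) -> R (x, z) -> 0 < W (2 * k) x y ->
  pos_finite (green b x z) -> pos_finite (green b y z).
Proof.
move=> Dx Rxy Rxz Wxy [g0 goo].
have Dy := Dinv Dx Rxy; have Ryx := Rs Rxy.
have rk : (0 < r ^+ (2 * k))%R by exact: exprn_gt0.
have step u v : D u -> R (u, v) -> R (u, z) ->
    W (2 * k) u v * green b v z <= (r ^+ (2 * k))%:E * green b u z.
  move=> Du Ruv Ruz; apply: le_trans (green_superharmonic k b Ruz).
  apply: (@le_esum_term _ _ _ (fun y => W (2 * k) u y * green b y z)).
    by move=> w _; rewrite mule_ge0 ?walk_ge0 ?green_ge0.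
  exact/xsectionP.
split.
  have := step _ _ Dy Ryx (Rt Ryx Rxz).
  rewrite -walk_sym// lt_neqAle green_ge0 andbT => H; apply/eqP => gy.
  move: H; rewrite -gy mule0 leNgt => /negP; apply.
  exact: mule_gt0.
have := step _ _ Dx Rxy Rxz; rewrite ltNge leye_eq => H; apply/negP => /eqP gy.
move: H; rewrite gy gt0_muley// leye_eq => /eqP H.
have : (r ^+ (2 * k))%:E * green b x z < +oo.
  by rewrite lte_mul_pinfty// lee_fin ltW.
by rewrite H.
Qed.

(** By [green_step], used in both directions, the points reached from [x] in [2 * k] steps select
    the same parity as [x]. The inequality for that one Green function thus passes to [weight]. *)
Lemma weight_superharmonic k x z : D x -> R (x, z) ->
  pos_finite (green 0 x z) \/ pos_finite (green 1 x z) ->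
  \esum_(y in xsection R x) W (2 * k) x y * (weight y z)%:E <=
  (r ^+ (2 * k) * weight x z)%:E.
Proof.
move=> Dx Rxz pxz.
have step b : pos_finite (green b x z) ->
    (forall y, R (x, y) -> 0 < W (2 * k) x y -> (weight y z)%:E <= green b y z) ->
    \esum_(y in xsection R x) W (2 * k) x y * (weight y z)%:E <=
    (r ^+ (2 * k) * fine (green b x z))%:E.
  move=> [g0 goo] le; rewrite EFinM fineK; last by rewrite ge0_fin_numE// ltW.
  apply: le_trans (green_superharmonic k b Rxz).
  apply: le_esum => y /xsectionP Rxy.
  have := walk_ge0 (2 * k) x y; rewrite le_eqVlt => /predU1P[<-|Wp].
    by rewrite !mul0e.
  by rewrite lee_wpmul2l ?walk_ge0// le.
have fle (h : \bar K) : 0 <= h -> (fine h)%:E <= h.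
  by case: h => [s| |]//; rewrite leey.
rewrite [weight x z]/weight; case: ifPn => [/asboolP p0|/asboolP np0].
  apply: step => // y Rxy Wp; rewrite /weight ifT.
    by apply: fle; exact: green_ge0.
  by apply/asboolP; exact: (green_step Dx Rxy Rxz Wp p0).
case: pxz => // p1; apply: step => // y Rxy Wp; rewrite /weight ifF.
  by apply: fle; exact: green_ge0.
apply/asboolPn => p0; apply: np0.
have Wyx : 0 < W (2 * k) y x by rewrite -walk_sym.
have Ryx := Rs Rxy.
exact: (green_step (Dinv Dx Rxy) Ryx (Rt Ryx Rxz) Wyx p0).
Qed.

Lemma weight_gt0 x z : pos_finite (green 0 x z) \/ pos_finite (green 1 x z) ->
  (0 < weight x z)%R.
Proof.
rewrite /weight; case: ifPn => [/asboolP|/asboolP n0 []]// [? ?].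
  by move=> _; rewrite fine_gt0//; apply/andP.
by rewrite fine_gt0//; apply/andP.
Qed.

(** With [b] the parity of [j], the walk of length [j] from [x] to [z] contributes a positive term
    to [green b x z]. Conversely, a walk of length [j] from [z] to [x] followed by one of length
    [2 * l + b] has even length [2 * (l + m)], where [2 * m = j + b]. Hence [W j z x * green b x z]
    is at most [r ^+ (2 * m)] times the finite [green 0 z z]. *)
Lemma green_proper x z : D z -> R (x, z) -> green 0 z z < +oo ->
  (exists j, 0 < W j x z) -> pos_finite (green 0 x z) \/ pos_finite (green 1 x z).
Proof.
move=> Dz Rxz goo [j Wj].
have Rzx := Rs Rxz; have Dx := Dinv Dz Rzx.
pose b := odd j : nat; pose m := (uphalf j).
have jm : (b + j = 2 * m)%N.
  by rewrite /b /m mul2n uphalf_half doubleD -addnn -addnA odd_double_half.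
have jh : (j = 2 * j./2 + b)%N by rewrite mul2n addnC odd_double_half.
suff : pos_finite (green b x z) by rewrite /b; case: odd => ?; [right|left].
split.
  have : (r ^- (2 * j./2))%:E * hit (2 * j./2 + b) x z <= green b x z.
    apply: (@le_esum_term _ _ _
      (fun l => (r ^- (2 * l))%:E * hit (2 * l + b) x z)) => //.
    by move=> l _; rewrite mule_ge0 ?hit_ge0.
  apply: lt_le_trans; rewrite mule_gt0//.
    by rewrite lte_fin invr_gt0 exprn_gt0.
  rewrite -jh; apply: (lt_le_trans Wj); apply: le_esum_term.
    by move=> w _; exact: walk_ge0.
  by apply/xsectionP; case: eqS.
have : W j z x * green b x z <= (r ^+ (2 * m))%:E * green 0 z z.
  apply: le_trans (green_shift m 0 z z).
  rewrite -esumZl ?walk_ge0//; last by move=> l _; rewrite mule_ge0// hit_ge0.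
  apply: le_esum => l _; rewrite muleCA lee_wpmul2l//.
  have -> : (2 * (l + m) + 0 = j + (2 * l + b))%N.
    by rewrite addn0 mulnDr -jm addnA addnC.
  rewrite (hit_add j)//.
  apply: (@le_esum_term _ _ _ (fun y => W j z y * hit (2 * l + b) y z)).
    by move=> w _; rewrite mule_ge0 ?walk_ge0 ?hit_ge0.
  exact/xsectionP.
rewrite ltNge leye_eq => H; apply/negP => /eqP gy.
move: H; rewrite gy gt0_muley; last by rewrite walk_sym.
rewrite leye_eq => /eqP H.
have : (r ^+ (2 * m))%:E * green 0 z z < +oo.
  by rewrite lte_mul_pinfty// lee_fin exprn_ge0// ltW.
by rewrite H.
Qed.

End walk.

(** * The walk on a conull invariant set *)

Section generators.
Context (K : realType) d (X : measurableType d) (B : nat -> set X)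
  (mu : probability X K) (R : set (X * X)) (nu : probability (fg_type X) K)
  (rep : set (X -> X) -> X -> X).
Hypotheses (sepB : separating B) (hR : discrete_pmp mu R)
  (hnu : countably_supported mu R nu) (hsym : symmetric_law mu R nu)
  (hrep : representatives mu R rep) (hgen : generates mu R nu rep).
Local Notation supp := (law_support mu R nu).
Local Notation p := (transition nu rep).
Local Notation W := (walk R nu rep).

Let mfg (A : set (fg_type X)) : measurable A.
Proof. exact: sub_sigma_algebra. Qed.

Lemma supp_sub C : C `<=` full_group mu R -> nu C = 1 -> supp `<=` C.
Proof.
move=> CG nuC c [_ nc]; apply: contrapT => Cc; apply: nc; apply/eqP.
rewrite -measure_le0; have : nu (C `|` [set c]) <= 1 by exact: probability_le1.
rewrite measureU//; last by apply/seteqP; split => // x [Cx] /= xc; rewrite xc in Cx.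
by rewrite [X in X + _]nuC -[leRHS]adde0 leeD2lE.
Qed.

Lemma supp_countable : countable supp.
Proof.
have [C [cC CG nuC]] := hnu; apply: sub_countable cC; apply: subset_card_le.
exact: supp_sub.
Qed.

(** The law is carried by a countable set, which an injection into [nat] splits into pieces with at
    most one element; elements of zero mass are then discarded. *)
Lemma law_esum (A : set (fg_type X)) :
  nu A = \esum_(c in A `&` supp) nu [set c].
Proof.
have [C [cC CG nuC]] := hnu.
have nuC0 : nu (~` C) = 0 by rewrite probability_setC// nuC subee.
have -> : nu A = nu (A `&` C).
  rewrite -[in LHS](setUIDK A C) measureU//; last first.
    by apply/seteqP; split => // x [[_ ?] []].
  rewrite [X in _ + X](_ : _ = 0) ?adde0//.
  apply: (subset_measure0 _ _ _ nuC0) => // x [_]; exact.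
have [f finj] := countable_injP _ cC.
pose F n := [set c | (A `&` C) c /\ f c = n].
have AF : A `&` C = \bigcup_n F n.
  by apply/seteqP; split => [c ACc|c [n _ []]]//; exists (f c).
have tF : trivIset setT F.
  by move=> i j _ _ [c [[_ ci] [_ cj]]]; rewrite -ci -cj.
transitivity (\esum_(c in A `&` C) nu [set c]).
  rewrite [in LHS]AF measure_semi_bigcup// [in RHS]AF nneseries_sum_bigcup//.
  apply: eq_eseriesr => n _.
  have [[c Fc]|Fn0] := pselect (exists c, F n c); last first.
    have -> : F n = set0 by apply/seteqP; split => // c Fc; apply: Fn0; exists c.
    by rewrite measure0 esum_set0.
  have -> : F n = [set c].
    apply/seteqP; split => [c' [[Ac' Cc'] fc']|_ ->//]; case: Fc => -[Ac Cc] fc.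
    by apply: finj; rewrite ?inE// fc.
  by rewrite esum_set1.
rewrite esum_mkcond [RHS]esum_mkcond; apply: eq_esum => c _.
have [Ac|nAc] := pselect (A c); last first.
  by rewrite !ifF//; apply/negbTE; rewrite notin_setE => -[].
have [sc|nsc] := pselect (supp c).
  by rewrite !ifT// inE//; split => //; exact: supp_sub sc.
rewrite [in RHS]ifF; last by apply/negbTE; rewrite notin_setE => -[].
case: ifPn => //; rewrite inE => -[_ Cc].
by apply: contrapT => nuc; apply: nsc; split => //; exact: CG.
Qed.

Lemma transition_le1 x : \esum_(y in xsection R x) p x y <= 1.
Proof.
apply: ge_ereal_sup => _ [Y [finY _] <-]; rewrite /transition -measure_fsbig//.
  exact: probability_le1.
by move=> y z _ _ [c [/= <- <-]].
Qed.

Lemma full_group_class (c : set (X -> X)) g : full_group mu R c -> c g ->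
  c = ae_class mu R g.
Proof.
case=> f _ <- [_ gf]; apply/seteqP; split => h [hR' hf]; split => //.
  by move: hf gf; apply: filterS2 => x -> ->.
by move: hf gf; apply: filterS2 => x -> ->.
Qed.

Lemma full_group_ae (c : set (X -> X)) g h : full_group mu R c -> c g -> c h ->
  {ae mu, forall x, g x = h x}.
Proof.
by case=> f _ <- [_ gf] [_ hf]; move: hf gf; apply: filterS2 => x -> ->.
Qed.

(** Membership of [inv_class c] in the full group is not verified by hand: by symmetry this class
    has positive mass, so it belongs to every set of full mass, and one of these lies inside the
    full group. *)
Lemma supp_inv c : supp c -> supp (inv_class c).
Proof.
case=> Gc nc; have nuE := hsym Gc.
have [C [cC CG nuC]] := hnu; rewrite nuE in nc; split => //; apply: CG.
apply: contrapT => Cc; apply: nc; apply/eqP.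
rewrite -measure_le0.
have : nu (C `|` [set inv_class c]) <= 1 by exact: probability_le1.
rewrite measureU//; last by apply/seteqP; split => // x [Cx] /= xc; rewrite xc in Cx.
by rewrite [X in X + _]nuC -[leRHS]adde0 leeD2lE.
Qed.

(** The representative of the common inverse class is a genuine inverse of an element of [c] and of
    an element of [c'], so these two elements coincide. *)
Lemma inv_class_inj c c' : supp c -> supp c' -> inv_class c = inv_class c' -> c = c'.
Proof.
move=> sc sc' cc'; have [Gic _] := supp_inv sc; have := hrep Gic.
set h := rep _ => -[g cg [gh hg]].
have := hrep Gic; rewrite -/h [in X in X -> _]cc' => -[g' cg' [gh' hg']].
have gg' : g = g' by apply/funext => x; rewrite -[RHS]hg gh'.
have [[Gc _] [Gc' _]] := (sc, sc').
by rewrite (full_group_class Gc cg) (full_group_class Gc' cg') gg'.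
Qed.

(** The representatives chosen for a class and for its inverse are mutually inverse only almost
    everywhere; [D] is a set where this holds pointwise. *)
Definition rep_inverse_on (D : set X) :=
  forall c x, supp c -> D x -> rep (inv_class c) (rep c x) = x.

(** Inversion injects the atoms sending [u] to [v] into those sending [v] to [u] and preserves their
    masses. Exchanging the roles of [u] and [v] gives equality. *)
Lemma transition_sym D x y : rep_inverse_on D -> D x -> D y -> p x y = p y x.
Proof.
move=> Dinv.
suff le u v : D u -> D v -> p u v <= p v u by move=> *; apply/eqP; rewrite eq_le !le.
move=> Du Dv; rewrite /transition (law_esum [set c | rep c u = v]).
apply: (@le_trans _ _ (\esum_(c in
    (fun c => @inv_class d X c) @` ([set c | rep c u = v] `&` supp)) nu [set c])).
  rewrite esum_image; last first.
    by move=> c c' /[!inE] -[_ sc] [_ sc']; exact: inv_class_inj.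
  by apply: le_esum => c [_ [Gc _]]; rewrite hsym.
rewrite [leRHS]law_esum; apply: le_esum_subset => // _ [c [/= cuv sc] <-].
by split; [rewrite -cuv Dinv|exact: supp_inv].
Qed.

Lemma rep_full_group c : supp c -> full_group_map setT mu R (rep c).
Proof. by case=> Gc _; have := hrep Gc; case: Gc => f _ <- []. Qed.

Lemma rep_measurable c : supp c -> measurable_fun setT (rep c).
Proof. by move/rep_full_group => []. Qed.

(** The inverse of a representative at every point, as [generated_group] requires;
    [rep (inv_class c)] may differ from it on a null set. *)
Definition inverse_map (f : X -> X) y := xget y [set x | f x = y].

Lemma inverse_mapP c : supp c ->
  [/\ cancel (rep c) (inverse_map (rep c)),
      cancel (inverse_map (rep c)) (rep c) &
      measurable_fun setT (inverse_map (rep c))].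
Proof.
move=> /rep_full_group[[_ rinj rsurj] mr mim _].
have fK : cancel (inverse_map (rep c)) (rep c).
  move=> y; rewrite /inverse_map; case: xgetP => //= H.
  by have [x _ xy] := rsurj y I; case: (H x).
have Kf : cancel (rep c) (inverse_map (rep c)).
  by move=> x; apply: (rinj _ _ (mem_set I) (mem_set I)); rewrite fK.
split => // _ Y mY; rewrite setTI; have := mim Y mY.
rewrite (_ : rep c @` Y = inverse_map (rep c) @^-1` Y).
  by apply.
apply/seteqP; split => [_ [x Yx <-]|y Yy]; first by rewrite /preimage/= Kf.
by exists (inverse_map (rep c) y) => //; rewrite fK.
Qed.

Lemma supp_enum : exists e : nat -> set (X -> X), range e = supp.
Proof.
have [[c sc]|no] := pselect (exists c, supp c).
  exact: countable_enum sc supp_countable.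
have := probability_setT nu; rewrite law_esum esum1; last first.
  by move=> c [_ sc]; case: no; exists c.
by move/eqP; rewrite eq_sym onee_eq0.
Qed.

Section words.
Variable e : nat -> set (X -> X).
Hypothesis esupp : range e = supp.

Definition letter (q : nat * bool) : X -> X :=
  if q.2 then rep (e q.1) else inverse_map (rep (e q.1)).

Definition word (w : seq (nat * bool)) (x : X) : X := foldr letter x w.

Let es n : supp (e n). Proof. by rewrite -esupp; exists n. Qed.

Lemma letterK q : cancel (letter (q.1, ~~ q.2)) (letter q).
Proof.
case: q => n [] /= x; have [K1 K2 _] := inverse_mapP (es n);
  by rewrite /letter/= ?K1 ?K2.
Qed.

Lemma word_measurable w : measurable_fun setT (word w).
Proof.
elim: w => [|q w IH]; first exact: measurable_id.
apply: measurableT_comp IH; rewrite /letter; case: q.2; first exact: rep_measurable.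
by have [] := inverse_mapP (es q.1).
Qed.

Lemma word_cat w w' x : word (w ++ w') x = word w (word w' x).
Proof. by rewrite /word foldr_cat. Qed.

Lemma word_generated :
  generated_group (rep @` supp) = [set g | exists w, g = word w].
Proof.
apply/seteqP; split => [g|_ [w ->]].
  apply; split => [|_ [c + <-]]; last first.
    by rewrite -esupp => -[n _ <-]; exists [:: (n, true)]; apply/funext.
  split; first by exists [::]; apply/funext.
    move=> _ _ [w ->] [w' ->]; exists (w ++ w').
    by apply/funext => x; rewrite word_cat.
  move=> _ h [w ->] wh hw.
  (* The inverse of a word is the reversed word with each letter inverted. *)
  exists (rev [seq (q.1, ~~ q.2) | q <- w]); apply/funext => x.
  apply: (can_inj wh); rewrite hw; apply/esym.
  elim: w x {wh hw} => // q w IH x /=; rewrite rev_cons -cats1 word_cat.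
  by rewrite IH [word [:: _] _]/= letterK.
move=> H [[Hid Hcomp Hinv] HG].
have Hrep n : H (rep (e n)) by apply: HG; exists (e n).
elim: w => [|q w IH]; first exact: Hid.
apply: (Hcomp (letter q) (word w)) => //; rewrite /letter; case: q.2 => //.
by have [? ? _] := inverse_mapP (es q.1); apply: Hinv (Hrep q.1) _ _.
Qed.

End words.

(** The countably many exceptional null sets are collected together with [N], and an invariant
    conull set avoiding them is extracted. The maps [g i] are the words in the support of the law,
    so each point [g i x] is reached with positive probability. *)
Lemma walk_setup (N : set X) : mu.-negligible N ->
  exists D g, [/\ enumerated R D g, mu (~` D) = 0, D `<=` ~` N,
    rep_inverse_on D & forall x i, D x -> exists j, 0 < W j x (g i x)].
Proof.
move=> N0; have [e esupp] := supp_enum.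
have es n : supp (e n) by rewrite -esupp; exists n.
have inv0 n : {ae mu, forall x, rep (inv_class (e n)) (rep (e n) x) = x}.
  have [Gn _] := es n; have [Gin _] := supp_inv (es n).
  have [g cg [gh hg]] := hrep Gin.
  have := full_group_ae Gn (hrep Gn) cg.
  by apply: filterS => x ->; exact: gh.
have : mu.-negligible (N `|`
    ~` [set x | [set g x | g in generated_group (rep @` supp)] = xsection R x]
    `|` \bigcup_n ~` [set x | rep (inv_class (e n)) (rep (e n) x) = x]).
  apply: negligibleU; first exact: negligibleU hgen.
  by apply: negligible_bigcup => n; exact: inv0.
move=> [M [mM M0 NM]].
(* Codes that decode to no word give the empty word, that is, the identity. *)
pose g i := word e (odflt [::] (choice.unpickle i)).
have mg i : measurable_fun setT (g i) by exact: word_measurable.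
have orb x : ~ M x -> xsection R x = range (g ^~ x).
  move=> Mx; have /contrapT <- :
      ~ ~ [set g x | g in generated_group (rep @` supp)] = xsection R x.
    by move=> H; apply: Mx; apply: NM; left; right.
  rewrite (word_generated esupp); apply/seteqP; split => [_ [_ [w ->] <-]|_ [i _ <-]].
    by exists (choice.pickle w) => //; rewrite /g choice.pickleK.
  by exists (g i) => //; eexists.
have [D enumD [D0 DM]] := enumerated_avoid_null sepB hR mM M0 mg orb.
have repD : rep_inverse_on D.
  move=> c x; rewrite -esupp => -[n _ <-] /DM Mx; apply: contrapT => H.
  by apply: Mx; apply: NM; right; exists n.
have [mD [Rr Rs Rt] Dinv _ orbD] := enumD.
exists D, g; split => //.
  by move=> x /DM Mx Nx; apply: Mx; apply: NM; left; left.
move=> x i Dx; rewrite /g; set w := odflt _ _ => {mg}.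
have inD v : R (x, word e v x).
  apply/xsectionP; rewrite orbD//; exists (choice.pickle v) => //.
  by rewrite /g choice.pickleK.
(* One step of the walk for each letter of the word. *)
exists (size w); elim: w => [|q v IH] /=; first by rewrite eqxx lte_fin.
have Dv : D (word e v x) by exact: Dinv (inD v).
apply: (@lt_le_trans _ _
  (W (size v) x (word e v x) * p (word e v x) (word e (q :: v) x))).
  rewrite mule_gt0//.
  have supp_gt0 c y : supp c -> 0 < p y (rep c y).
    move=> [_ nc]; apply: (@lt_le_trans _ _ (nu [set c])).
      by rewrite lt_neqAle measure_ge0 andbT eq_sym; exact/eqP.
    by rewrite /transition; apply: le_measure; rewrite ?inE// => _ ->.
  rewrite /= /letter; case: q => n b /=; case: b; first exact: supp_gt0.
  have [K1 K2 _] := inverse_mapP (es n).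
  set y := word e v x in Dv *; set z := inverse_map _ y.
  have Rz : R (x, z) by exact: (inD ((n, false) :: v)).
  have Dz := Dinv _ _ Dx Rz.
  (* An inverse letter is not itself the representative of an atom, but at points of [D] it agrees
     with the representative of the inverse class, which has positive mass. *)
  have <- : rep (inv_class (e n)) y = z by rewrite -(repD _ _ (es n) Dz) K2.
  exact/supp_gt0/supp_inv.
apply: (@le_esum_term _ _ _ (fun y => W (size v) x y * p y (word e (q :: v) x))).
  by move=> y _; rewrite mule_ge0 ?walk_ge0 ?transition_ge0.
exact/xsectionP.
Qed.

End generators.

(** * Measurability along the classes *)

Section kernels.
Context (K : realType) d (X : measurableType d) (B : nat -> set X)
  (mu : probability X K) (R S : set (X * X)) (nu : probability (fg_type X) K)
  (rep : set (X -> X) -> X -> X) (D : set X) (g : nat -> X -> X).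
Hypotheses (sepB : separating B)
  (hnu : countably_supported mu R nu) (hrep : representatives mu R rep)
  (enumD : enumerated R D g) (SR : subrelation S R).
Local Notation p := (transition nu rep).
Local Notation W := (walk R nu rep).

Let Rr : forall x, R (x, x). Proof. by case: enumD => _ []. Qed.
Let Rs : forall x y, R (x, y) -> R (y, x). Proof. by case: enumD => _ []. Qed.
Let Rt : forall x y z, R (x, y) -> R (y, z) -> R (x, z).
Proof. by case: enumD => _ []. Qed.
Let mD : measurable D. Proof. exact: enum_measurable enumD. Qed.

Lemma enum_class x y : R (x, y) -> xsection R x = xsection R y.
Proof. exact: xsection_equiv. Qed.

Definition inner_map (f : X -> X) :=
  measurable_fun setT f /\ forall x, D x -> R (x, f x).

Lemma inner_map_id : inner_map id.
Proof. by split => // x _; exact: Rr. Qed.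

Lemma inner_map_g i : inner_map (g i).
Proof.
split=> [|x Dx]; first exact: enum_fun enumD i.
by apply/xsectionP; rewrite (enum_orbit enumD Dx); exists i.
Qed.

Lemma inner_map_comp f h : inner_map f -> inner_map h -> inner_map (f \o h).
Proof.
move=> [mf Rf] [mh Rh]; split=> [|x Dx]; first exact: measurableT_comp.
by apply: (Rt (Rh _ Dx)); apply: Rf; apply: enum_invariant enumD _ _ Dx (Rh _ Dx).
Qed.

(** Measurability of a kernel on [R], tested along Borel choices of two points in the class of [t].
    Unlike measurability on the product, this form is easily preserved by sums over classes. *)
Definition borel_kernel (F : X -> X -> \bar K) :=
  forall f h, inner_map f -> inner_map h -> measurable_fun D (fun t => F (f t) (h t)).

Lemma measurable_setI_fun (f : X -> X) (A : set X) :
  measurable_fun setT f -> measurable A -> measurable (D `&` f @^-1` A).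
Proof. by move=> mf mA; exact: measurable_funTS. Qed.

Lemma measurable_rel (Q : set (X * X)) (f h : X -> X) : measurable Q ->
  measurable_fun setT f -> measurable_fun setT h ->
  measurable [set t | Q (f t, h t)].
Proof.
move=> mQ mf mh; rewrite -[X in measurable X]setTI.
by apply: (measurable_fun_pair mf mh).
Qed.

(** By [esum_first_index] the sum is a series in [i]. The condition that [i] is the first index of
    its point is Borel, since it only involves coincidence sets of the Borel maps [g j]. *)
Lemma measurable_class_sum (G : X -> X -> \bar K) :
  (forall t y, 0 <= G t y) ->
  (forall i, measurable_fun D (fun t => G t (g i t))) ->
  measurable_fun D (fun t => \esum_(y in xsection R t) G t y).
Proof.
move=> G0 mG.
apply: (eq_measurable_fun (fun t => \sum_(0 <= i <oo)
    if `[< setT i /\ forall j, (j < i)%N -> setT j -> g j t <> g i t >]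
    then G t (g i t) else 0)).
  by move=> t /[!inE] Dt; rewrite (enum_orbit enumD Dt) esum_first_index.
apply: measurable_nneseries => [i t Dt|i]; first by case: ifPn.
apply: measurable_fun_ifprop => //; apply: measurableI => //.
rewrite (_ : [set t | _] =
    \bigcap_(j in [set j | (j < i)%N]) ~` [set t | g j t = g i t]).
  apply: bigcap_measurableType => j _.
  apply: measurableC; apply: (measurable_eq_set sepB); exact: enum_fun enumD _.
apply/seteqP; split => t /= H; first by case: H => _ H j ji; exact: H.
by split => // j ji _; exact: H.
Qed.

Lemma measurable_transition : borel_kernel p.
Proof.
move=> f h [mf _] [mh _]; have [e esupp] := supp_enum hnu.
have es n : law_support mu R nu (e n) by rewrite -esupp; exists n.
have pE t : p (f t) (h t) = \sum_(0 <= i <oo)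
    if `[< setT i /\ forall j, (j < i)%N -> setT j -> e j <> e i >]
    then (if `[< rep (e i) (f t) = h t >] then nu [set e i] else 0) else 0.
  rewrite /transition (law_esum hnu) setIC esum_mkcondr -esupp.
  rewrite esum_first_index; last by move=> i _; case: ifPn.
  apply: eq_eseriesr => i _; congr (if _ then _ else _).
apply: (eq_measurable_fun _ (fun t _ => esym (pE t))).
apply: measurable_nneseries => [i t _|i]; first by case: ifPn => // _; case: ifPn.
set q := `[< setT i /\ _ >]; case: q; last exact: measurable_cst.
apply: measurable_fun_ifprop => //; apply: measurableI => //.
apply: (measurable_eq_set sepB) => //.
by apply: measurableT_comp => //; exact: (rep_measurable hrep).
Qed.

Lemma measurable_walk k : borel_kernel (W k).
Proof.
elim: k => [f h [mf _] [mh _]|k IH f h fi hi].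
  apply: (eq_measurable_fun (fun t => if `[< f t = h t >] then 1 else 0)).
    move=> t _ /=; have [->|ft] := eqVneq (f t) (h t); first by rewrite asboolT.
    by rewrite asboolF//; exact/eqP.
  apply: measurable_fun_ifprop => //; apply: measurableI => //.
  exact: (measurable_eq_set sepB).
apply: (eq_measurable_fun (fun t =>
    \esum_(y in xsection R t) W k (f t) y * p y (h t))).
  by move=> t /[!inE] Dt /=; rewrite (enum_class (fi.2 _ Dt)).
apply: measurable_class_sum => [t y|i].
  by rewrite mule_ge0 ?walk_ge0 ?transition_ge0.
apply: emeasurable_funM; first by apply: IH => //; exact: inner_map_g.
by apply: measurable_transition => //; exact: inner_map_g.
Qed.

Lemma measurable_hit k : borel_kernel (hit R S nu rep k).
Proof.
move=> f h fi hi; have [mS _ SsubR] := SR.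
apply: (eq_measurable_fun (fun t => \esum_(y in xsection R t)
    if `[< S (h t, y) >] then W k (f t) y else 0)).
  move=> t /[!inE] Dt; rewrite /hit [RHS]esum_mkcond esum_mkcond.
  apply: eq_esum => y _; rewrite !mem_xsection.
  case: ifPn => [/[!inE] Rty|Rty].
    by congr (if _ then _ else _); apply/asboolP/idP => [H|/[!inE]//]; exact: mem_set.
  case: ifPn => // /[!inE] /SsubR Rhy; move: Rty.
  by rewrite notin_setE => -[]; apply: Rt Rhy; exact: hi.2.
apply: measurable_class_sum => [t y|i]; first by case: ifPn => // _; exact: walk_ge0.
apply: measurable_fun_ifprop; last by apply: measurable_walk => //; exact: inner_map_g.
apply: measurableI => //; apply: measurable_rel => //; first exact: hi.1.
exact: enum_fun enumD i.
Qed.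

Variable r : K.
Hypothesis r0 : (0 < r)%R.

Lemma measurable_green b : borel_kernel (green R S nu rep r b).
Proof.
move=> f h fi hi; have c0 l : 0 <= (r ^- (2 * l))%:E.
  by rewrite lee_fin invr_ge0 exprn_ge0// ltW.
apply: (eq_measurable_fun (fun t => \sum_(0 <= l <oo)
    (r ^- (2 * l))%:E * hit R S nu rep (2 * l + b) (f t) (h t))).
  by move=> t _; rewrite nneseries_esumT// => l; rewrite mule_ge0 ?hit_ge0.
apply: measurable_nneseries => [l t _|l]; first by rewrite mule_ge0 ?hit_ge0.
by apply: measurable_funeM; exact: measurable_hit.
Qed.

Lemma measurable_weight f h : inner_map f -> inner_map h ->
  measurable_fun D (fun t => weight R S nu rep r (f t) (h t)).
Proof.
move=> fi hi; apply: measurableT_comp; first exact: fine_measurable.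
apply: measurable_fun_if => //; last 2 first.
- by apply: measurable_funS (measurable_green 0 fi hi) => // t [].
- by apply: measurable_funS (measurable_green 1 fi hi) => // t [].
apply: (@measurable_fun_bool _ _ _ _ true).
rewrite (_ : _ @^-1` _ = (fun t => green R S nu rep r 0 (f t) (h t)) @^-1`
    [set` Interval (BRight 0%E) (BLeft +oo%E)]); last first.
  apply/seteqP; split => t /=; rewrite /preimage/= in_itv/=.
    by move=> /asboolP[-> ->].
  by move=> /andP[? ?]; exact/asboolP.
by apply: (measurable_green 0 fi hi) => //; exact: emeasurable_itv.
Qed.

Lemma measurable_ratio f h k : inner_map f -> inner_map h -> inner_map k ->
  measurable_fun D (fun t =>
    (weight R S nu rep r (h t) (k t) / weight R S nu rep r (f t) (k t))%R).
Proof.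
move=> fi hi ki; apply: measurable_funM; first exact: measurable_weight.
apply: (eq_measurable_fun (fun t => (weight R S nu rep r (f t) (k t)) `^ (-1))%R).
  by move=> t _; rewrite powR_inv1// weight_ge0.
by apply: (measurableT_comp (measurable_powR _)); exact: measurable_weight.
Qed.

End kernels.

(** * Borel involutions and measurable functions on the quotient *)

Section swap.
Context (K : realType) d (X : measurableType d) (B : nat -> set X)
  (E : set X) (m : {measure set X -> \bar K}) (Q : set (X * X)).
Hypotheses (sepB : separating B) (mE : measurable E) (mQ : measurable Q)
  (eqQ : equivalence_relation Q).
Variables (f h : X -> X) (V : set X).
Hypotheses (mf : measurable_fun setT f) (mh : measurable_fun setT h)
  (mV : measurable V).

(* Since [f] moves its points out of [V], [swap_dom] is disjoint from its image
   under [f], so that [swap] is an involution, as in the Feldman-Moore theorem. *)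
Definition swap_dom : set X :=
  [set x | [/\ E x, E (f x), Q (x, f x), h (f x) = x & V x /\ ~ V (f x)]].

Definition swap x := if `[< swap_dom x >] then f x
  else if `[< swap_dom (h x) /\ f (h x) = x >] then h x else x.

Let mpre (k : X -> X) (A : set X) : measurable_fun setT k -> measurable A ->
  measurable (k @^-1` A).
Proof. by move=> mk mA; rewrite -[X in measurable X]setTI; exact: mk. Qed.

Let mdom : measurable swap_dom.
Proof.
rewrite (_ : swap_dom = E `&` f @^-1` E `&` [set x | Q (x, f x)] `&`
    [set x | h (f x) = x] `&` (V `&` ~` (f @^-1` V))); last first.
  by apply/seteqP; split => [x [? ? ? ? []]|x [[[[? ?] ?] ?] []]].
do ![apply: measurableI] => //.
- exact: mpre.
- exact: (measurable_rel mQ (@measurable_id _ _ setT) mf).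
- apply: (measurable_eq_set sepB) => //; exact: measurableT_comp.
- by apply: measurableC; exact: mpre.
Qed.

Lemma swap_involutive : involutive swap.
Proof.
have s1 x : swap_dom x -> swap x = f x by move=> Ax; rewrite /swap asboolT.
have s2 x : swap_dom (h x) -> f (h x) = x -> swap x = h x.
  move=> Ahx fhx; rewrite /swap asboolF ?asboolT// => -[_ _ _ _ [Vx _]].
  by case: Ahx => _ _ _ _ [_]; rewrite fhx.
move=> x; have [Ax|nAx] := pselect (swap_dom x).
  have hfx : h (f x) = x by case: Ax.
  by rewrite (s1 x)// s2 hfx.
have [[Ahx fhx]|nAhx] := pselect (swap_dom (h x) /\ f (h x) = x).
  by rewrite (s2 x)// s1.
have sx : swap x = x by rewrite /swap !asboolF.
by rewrite !sx.
Qed.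

Lemma swap_rel x : E x -> restrict_rel E Q (x, swap x).
Proof.
have [Qr Qs _] := eqQ.
move=> Ex; rewrite /swap; case: ifPn => [/asboolP[? ? ? _ _]//|_].
case: ifPn => [/asboolP[[Ehx Efhx Qhx _ _] fhx]|_]; last by split => //; exact: Qr.
by split => //=; apply: Qs; rewrite -[X in Q (_, X)]fhx.
Qed.

Lemma swap_measurable : measurable_fun setT swap.
Proof.
have mb (A : set X) : measurable A -> measurable_fun setT (fun x => `[< A x >]).
  move=> mA; apply: (@measurable_fun_bool _ _ _ _ true).
  rewrite (_ : _ @^-1` _ = A) ?setTI//.
  by apply/seteqP; split => x /asboolP.
apply: measurable_fun_ifT => //; first exact: mb.
apply: measurable_fun_ifT => //; apply: (mb [set x | swap_dom (h x) /\ f (h x) = x]).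
apply: measurableI; first exact: (mpre mh mdom).
apply: (measurable_eq_set sepB) => //; exact: measurableT_comp.
Qed.

(** For an involution, images are preimages, so measurability of the map gives that of images. These
    maps are the elements of the full group on which [quot_borel] will be tested. *)
Lemma swap_full_group : full_group_map E m (restrict_rel E Q) swap.
Proof.
have Es x : E x -> E (swap x) by move=> /swap_rel[_ []].
split.
- split => [x /Es//|x y _ _ /(congr1 swap)|y Ey]; first by rewrite !swap_involutive.
  by exists (swap y); [exact: Es|exact: swap_involutive].
- by apply: measurable_funTS; exact: swap_measurable.
- move=> A mA AE; rewrite (_ : _ @` _ = swap @^-1` A).
    exact: mpre swap_measurable _.
  apply/seteqP; split => [_ [x Ax <-]|x Ax]; first by rewrite /preimage/= swap_involutive.
  by exists (swap x) => //; exact: swap_involutive.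
- by apply: aeW => x; exact: swap_rel.
Qed.

End swap.

Section quotient.
Context (K : realType) d (X : measurableType d) (B : nat -> set X)
  (R S1 S2 : set (X * X)) (D : set X) (g : nat -> X -> X)
  (E : set X) (m : {measure set X -> \bar K}).
Hypotheses (sepB : separating B) (enumD : enumerated R D g) (mE : measurable E)
  (S2R : subrelation S2 R) (S12 : subrelation S1 S2).
Local Notation Q1 := (restrict_rel E S1).
Local Notation Q2 := (restrict_rel E S2).

Let mS1 : measurable S1. Proof. by case: S12. Qed.
Let mS2 : measurable S2. Proof. by case: S2R. Qed.
Let eqS1 : equivalence_relation S1. Proof. by case: S12. Qed.
Let eqS2 : equivalence_relation S2. Proof. by case: S2R. Qed.
Let sub12 : S1 `<=` S2. Proof. by case: S12. Qed.

Lemma restrict_rel_measurable (S : set (X * X)) : measurable S ->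
  measurable (restrict_rel E S).
Proof. by move=> mS; apply: measurableI => //; exact: measurableX. Qed.

Lemma restrict_class_eq z z' : E z -> E z' ->
  xsection Q1 z = xsection Q1 z' <-> S1 (z, z').
Proof.
move=> Ez Ez'; have [Sr Ss St] := eqS1; split => [zz'|Szz'].
  have : xsection Q1 z' z' by apply/xsectionP; split => //; exact: Sr.
  by rewrite -zz' => /xsectionP[].
apply/seteqP; split => y /xsectionP[Szy [_ Ey]]; apply/xsectionP; split => //.
  exact: St (Ss _ _ Szz') Szy.
exact: St Szz' Szy.
Qed.

Lemma quot_relE x z : E x -> E z ->
  @quot_rel K d X E m Q2 Q1 (x, xsection Q1 z) <-> S2 (x, z).
Proof.
move=> Ex Ez; have [Sr Ss St] := eqS2; split => [[_ [y /xsectionP[Sxy [_ Ey]]]]|Sxz].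
  by move=> /(restrict_class_eq Ey Ez)/sub12; exact: St.
by split => //; exists z => //; apply/xsectionP.
Qed.

Lemma quot_borel_fun (A : set (X * set X)) :
  measurable (A : set (g_sigma_algebraType (quot_borel E m Q2 Q1))) ->
  quot_borel E m Q2 Q1 A.
Proof.
move=> mA; have := mA; rewrite /measurable/= sigma_algebra_id//.
exact: quot_borel_sigma_algebra.
Qed.

Lemma quot_rel_measurable : measurable (@quot_rel K d X E m Q2 Q1).
Proof.
apply: sub_sigma_algebra => s [[sE _ _] ms _ _].
(* An element of the full group is only measurable on [E]; it is extended by the identity. *)
pose s' x := if `[< E x >] then s x else x.
have ms' : measurable_fun setT s'.
  have EE : (fun x => `[< E x >]) @^-1` [set true] = E.
    by apply/seteqP; split => x /asboolP.
  apply: measurable_fun_if => //; last by rewrite EE setTI.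
  by apply: (@measurable_fun_bool _ _ _ _ true); rewrite EE setTI.
rewrite (_ : _ `&` _ = E `&` [set x | S2 (x, s' x)]).
  by apply: measurableI => //; exact: (measurable_rel mS2 (@measurable_id _ _ setT) ms').
apply/seteqP; split => x /= [Ex H]; split => //; move: H;
  rewrite quot_relE// ?/s' ?asboolT//; exact: sE.
Qed.

Lemma normc_sqrE (z : K[i]) :
  (ComplexField.Normc.normc z ^+ 2 = complex.Re z ^+ 2 + complex.Im z ^+ 2)%R.
Proof. by case: z => a b /=; rewrite sqr_sqrtr// addr_ge0// sqr_ge0. Qed.

Lemma L2_sqr_normc_measurable xi : @L2 K d X E m Q2 Q1 xi ->
  measurable_fun (@quot_rel K d X E m Q2 Q1)
    (fun q => ComplexField.Normc.normc (xi q) ^+ 2)%R.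
Proof.
move=> [mRe mIm _].
apply: (eq_measurable_fun (fun q => complex.Re (xi q) ^+ 2 + complex.Im (xi q) ^+ 2)%R).
  by move=> q _; rewrite normc_sqrE.
by apply: measurable_funD; apply: measurable_funX.
Qed.

(** If [y = g i x], [x = g j y] and [B n] contains [x] but not [y], then [x] lies in the domain of
    the corresponding swap. The value [None] stands for the identity. *)
Lemma swap_cover x y : D x -> E x -> E y -> S2 (x, y) ->
  exists q : option (nat * nat * nat),
    y = if q is Some (i, j, n) then swap E S2 (g i) (g j) (B n) x else x.
Proof.
move=> Dx Ex Ey Sxy; have [xy|xy] := pselect (x = y); first by exists None.
have [_ sB] := sepB; have [n [Bx By]] := sB _ _ xy.
have [_ _ SR] := S2R; have [_ [Rr Rs Rt] Dinv _ orb] := enumD.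
have Rxy := SR _ Sxy; have Dy := Dinv _ _ Dx Rxy.
have : xsection R x y by exact/xsectionP.
rewrite orb// => -[i _ gi]; have : xsection R y x by apply/xsectionP; exact: Rs.
rewrite orb// => -[j _ gj]; exists (Some (i, j, n)).
by rewrite /swap asboolT// /swap_dom/= gi.
Qed.

(** Elements of [L2] are measurable along full group elements only, whereas [f] and [h] need not be
    injective. By [swap_cover] the domain splits into countably many Borel pieces on which [h] is a
    fixed full group element composed with [f], and there the definition of [quot_borel] applies. *)
Lemma L2_kernel_measurable xi f h : @L2 K d X E m Q2 Q1 xi ->
  inner_map R D f -> inner_map R D h ->
  measurable_fun (D `&` [set t | Q2 (f t, h t)])
    (fun t => (ComplexField.Normc.normc (xi (f t, xsection Q1 (h t))) ^+ 2)%R).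
Proof.
move=> L2xi fi hi; have mD := enum_measurable enumD.
pose s n : X -> X := if choice.unpickle n is Some (Some (i, j, n)) then
  swap E S2 (g i) (g j) (B n) else id.
have ms n : measurable_fun setT (s n).
  rewrite /s; case: choice.unpickle => [[[[i j] k]|]|] //.
  apply: (swap_measurable sepB) => //; try exact: enum_fun enumD _.
  by case: sepB.
have sfg n : full_group_map E m Q2 (s n).
  have idfg : full_group_map E m Q2 id.
    have [Sr _ _] := eqS2; split => // [|A mA _|]; last 2 first.
    - by rewrite image_id.
    - by apply: aeW => x Ex; split => //; exact: Sr.
    by split => // y Ey; exists y.
  rewrite /s; case: choice.unpickle => [[[[i j] k]|]|].
  - apply: (swap_full_group m sepB) => //; try exact: enum_fun enumD _.
    by case: sepB.
  - exact: idfg.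
  - exact: idfg.
have sE n x : E x -> E (s n x) by have [[sE _ _] _ _ _] := sfg n; exact: sE.
pose A n := D `&` [set t | Q2 (f t, h t)] `&` [set t | h t = s n (f t)].
have mA n : measurable (A n).
  apply: measurableI; last first.
    apply: (measurable_eq_set sepB); first exact: hi.1.
    by apply: measurableT_comp; [exact: ms|exact: fi.1].
  apply: measurableI => //; apply: measurable_rel; [|exact: fi.1|exact: hi.1].
  exact: restrict_rel_measurable.
have -> : D `&` [set t | Q2 (f t, h t)] = \bigcup_n A n.
  apply/seteqP; split => [t [Dt Qt]|t [n _ []]//].
  have [_ _ Dinv _ _] := enumD; have Dft := Dinv _ _ Dt (fi.2 _ Dt).
  have [/= Sfh [/= Ef Eh]] := Qt.
  have [q hq] := swap_cover Dft Ef Eh Sfh; exists (choice.pickle q) => //.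
  by split => //; rewrite /= hq /s choice.pickleK; case: q {hq} => [[[]]|].
apply/measurable_fun_bigcup => // n _ Y mY.
pose v q := (ComplexField.Normc.normc (xi q) ^+ 2)%R.
have mv := L2_sqr_normc_measurable L2xi.
have := quot_borel_fun (mv quot_rel_measurable Y mY).
move=> /(_ _ (sfg n)) mAY.
rewrite (_ : _ `&` _ = A n `&` f @^-1` (E `&` [set x |
   (@quot_rel K d X E m Q2 Q1 `&` v @^-1` Y) (x, xsection Q1 (s n x))])).
  by apply: measurableI => //; rewrite -[X in measurable X]setTI; exact: fi.1.
apply/seteqP; split => t [At]; last first.
  case=> _ [_]; rewrite /v /preimage/= => Yt; split => //.
  by have [_ /= ->] := At.
have [[Dt [/= Sfh [Ef Eh]]] /= hs] := At.
rewrite /preimage/= hs => Yt; split => //; split => //; split => //.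
by apply/quot_relE => //; [exact: sE|rewrite -hs].
Qed.

End quotient.

(** * The Schur test *)

Section class_sums.
Context (K : realType) d (X : measurableType d) (R S1 S2 : set (X * X))
  (D : set X) (g : nat -> X -> X) (E : set X).
Hypotheses (enumD : enumerated R D g) (mE : measurable E)
  (S2R : subrelation S2 R) (S12 : subrelation S1 S2).
Local Notation Q1 := (restrict_rel E S1).
Local Notation Q2 := (restrict_rel E S2).

(** The analogue of [measurable_class_sum] for sums over [S1]-classes. A class is counted at the
    first [g i (f t)] that represents it, and equality of two represented classes is the Borel
    condition that their representatives are [S1]-related. *)
Lemma measurable_classes_sum f (G : X -> set X -> \bar K) :
  inner_map R D f -> (forall t c, 0 <= G t c) ->
  (forall i, measurable_fun (D `&` [set t | Q2 (f t, g i (f t))])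
    (fun t => G t (xsection Q1 (g i (f t))))) ->
  measurable_fun D (fun t => \esum_(c in classes_in Q2 Q1 (f t)) G t c).
Proof.
move=> fi G0 mG; have mD := enum_measurable enumD.
have [mS1 _ _] := S12; have [mS2 _ SR] := S2R.
pose J t := [set i | Q2 (f t, g i (f t))].
have clsE t : D t ->
    classes_in Q2 Q1 (f t) = (fun i => xsection Q1 (g i (f t))) @` J t.
  move=> Dt; have Dft := enum_invariant enumD Dt (fi.2 _ Dt).
  apply/seteqP; split => [_ [y /xsectionP Qy <-]|_ [i Qi <-]].
    have : xsection R (f t) y by apply/xsectionP/SR; case: Qy.
    by rewrite (enum_orbit enumD Dft) => -[i _ gi]; exists i; rewrite /J/= ?gi.
  by exists (g i (f t)) => //; apply/xsectionP.
apply: (eq_measurable_fun (fun t => \sum_(0 <= i <oo)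
    if `[< J t i /\ forall j, (j < i)%N -> J t j ->
      xsection Q1 (g j (f t)) <> xsection Q1 (g i (f t)) >]
    then G t (xsection Q1 (g i (f t))) else 0)).
  by move=> t /[!inE] Dt; rewrite clsE// esum_first_index.
apply: measurable_nneseries => [i t _|i]; first by case: ifPn.
have mgf j : measurable_fun setT (fun t => g j (f t)).
  by apply: measurableT_comp; [exact: enum_fun enumD _|exact: fi.1].
have mJ i' : measurable [set t | J t i'].
  apply: measurable_rel; [exact: restrict_rel_measurable|exact: fi.1|exact: mgf].
have mP : measurable [set t | J t i /\ forall j, (j < i)%N -> J t j ->
      xsection Q1 (g j (f t)) <> xsection Q1 (g i (f t))].
  rewrite (_ : [set t | _] = [set t | J t i] `&` \bigcap_(j in [set j | (j < i)%N])
    ~` ([set t | J t j] `&` [set t | S1 (g j (f t), g i (f t))])).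
    apply: measurableI => //; apply: bigcap_measurableType => j _.
    apply: measurableC; apply: measurableI => //.
    by apply: measurable_rel.
  apply/seteqP; split => t /= [Ji H]; split => // j ji; have Ei := Ji.2.2.
    by move=> [Jj Sji]; apply: (H j ji Jj); apply/(restrict_class_eq S12 Jj.2.2 Ei).
  by move=> Jj /(restrict_class_eq S12 Jj.2.2 Ei) Sji; apply: (H j ji).
apply: measurable_fun_ifprop_in; first exact: measurableI.
apply: (measurable_funS _ _ (mG i)); first exact: (measurableI _ _ mD (mJ i)).
by move=> t [Dt [Jt _]].
Qed.

End class_sums.

Section schur.
Context (K : realType) d (X : measurableType d) (B : nat -> set X)
  (mu : probability X K) (R S1 S2 : set (X * X))
  (nu : probability (fg_type X) K) (rep : set (X -> X) -> X -> X)
  (D : set X) (g : nat -> X -> X) (E : set X) (r : K).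
Hypotheses (sepB : separating B) (hR : discrete_pmp mu R)
  (hnu : countably_supported mu R nu) (hsym : symmetric_law mu R nu)
  (hrep : representatives mu R rep)
  (enumD : enumerated R D g) (repD : rep_inverse_on mu R nu rep D)
  (walkD : forall x i, D x -> exists j, 0 < walk R nu rep j x (g i x))
  (mE : measurable E) (S2R : subrelation S2 R) (S12 : subrelation S1 S2)
  (r0 : (0 < r)%R).
Local Notation Q1 := (restrict_rel E S1).
Local Notation Q2 := (restrict_rel E S2).
Local Notation W := (walk R nu rep).
Local Notation wgt := (weight R S1 nu rep r).
Hypothesis green_E : forall z, D z -> E z -> green R S1 nu rep r 0 z z < +oo.

Variables (Ebar : set X) (theta : X -> X).
Hypotheses (mEbar : measurable Ebar) (EbarD : Ebar `<=` D)
  (theta_inner : inner_map R D theta)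
  (thetaE : forall x, Ebar x -> E (theta x))
  (thetaS : forall x, Ebar x -> S2 (x, theta x))
  (EbarS : forall x y, Ebar x -> S2 (x, y) -> Ebar y).

Variable v : X -> set X -> K.
Hypotheses (v0 : forall x c, (0 <= v x c)%R)
  (v1 : forall x, D x -> E x ->
    \esum_(c in classes_in Q2 Q1 x) (v x c ^+ 2)%:E = 1)
  (mv : forall f h, inner_map R D f -> inner_map R D h ->
    measurable_fun (D `&` [set t | Q2 (f t, h t)])
      (fun t => (v (f t) (xsection Q1 (h t)) ^+ 2)%R)).

Let eqR : equivalence_relation R. Proof. by case: enumD. Qed.
Let eqS1 : equivalence_relation S1. Proof. by case: S12. Qed.
Let eqS2 : equivalence_relation S2. Proof. by case: S2R. Qed.
Let S1R : S1 `<=` R.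
Proof. by move=> p; case: S12 => _ _ /[apply]; case: S2R => _ _; apply. Qed.
Let subS1R : subrelation S1 R. Proof. by case: S12. Qed.
Let Dinv x y : D x -> R (x, y) -> D y. Proof. exact: enum_invariant enumD x y. Qed.
Let p_sym x y : D x -> R (x, y) -> transition nu rep x y = transition nu rep y x.
Proof.
move=> Dx Rxy; apply: (transition_sym hnu hsym hrep repD) => //.
exact: Dinv Rxy.
Qed.
Let W_sym k x y : D x -> R (x, y) -> W k x y = W k y x.
Proof. exact: walk_sym. Qed.

(** The weight depends on the class only, so any chosen point of [c] will do; [y] is the default for
    empty [c]. *)
Definition class_weight y (c : set X) : K := wgt y (xget y c).

Let cwE y z : E z -> class_weight y (xsection Q1 z) = wgt y z.
Proof.
move=> Ez; rewrite /class_weight; case: xgetP => [w _ /xsectionP[Szw _]|/(_ z) []].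
  exact/esym/weight_class.
by apply/xsectionP; split => //; case: eqS1.
Qed.

Let clsP x c : Ebar x -> classes_in Q2 Q1 (theta x) c ->
  exists z, [/\ E z, D z, S2 (x, z) & c = xsection Q1 z].
Proof.
move=> Ex [z /xsectionP[Sz [_ Ez]] <-]; exists z.
have [_ _ St] := eqS2; have Sxz : S2 (x, z) by exact: St (thetaS Ex) Sz.
by split => //; apply: Dinv (EbarD Ex) _; case: S2R => _ _; exact.
Qed.

Let S2R' : S2 `<=` R. Proof. by case: S2R. Qed.

Let green_ok x z : D z -> E z -> R (x, z) ->
  pos_finite (green R S1 nu rep r 0 x z) \/ pos_finite (green R S1 nu rep r 1 x z).
Proof.
move=> Dz Ez Rxz; have [_ Rs _] := eqR; have Dx := Dinv Dz (Rs _ _ Rxz).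
apply: (green_proper eqR eqS1 S1R Dinv p_sym r0 Dz Rxz (green_E Dz Ez)).
have : xsection R x z by exact/xsectionP.
by rewrite (enum_orbit enumD Dx) => -[i _ <-]; exact: walkD.
Qed.

Let cw_gt0 x y c : Ebar x -> R (x, y) -> classes_in Q2 Q1 (theta x) c ->
  (0 < class_weight y c)%R.
Proof.
move=> Ex Rxy /(clsP Ex)[z [Ez Dz Sxz ->]]; rewrite cwE//.
apply/weight_gt0/green_ok => //; have [_ Rs Rt] := eqR.
by apply: Rt (Rs _ _ Rxy) _; exact: S2R'.
Qed.

(** One of the two halves in the weighted inequality [2 p q <= p^2 (a / b) + q^2 (b / a)], with [a]
    and [b] the weights at [y] and [x]. The other half is the same expression with [x] and [y]
    exchanged. *)
Definition schur k x y : \bar K := if `[< Ebar x >] then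
  W (2 * k) x y * \esum_(c in classes_in Q2 Q1 (theta x))
    (v (theta x) c ^+ 2 * (class_weight y c / class_weight x c))%:E
  else 0.

Let cw_ge0 y c : (0 <= class_weight y c)%R. Proof. exact: weight_ge0. Qed.

Let term_ge0 x y c :
  0 <= (v (theta x) c ^+ 2 * (class_weight y c / class_weight x c))%:E.
Proof. by rewrite lee_fin mulr_ge0 ?sqr_ge0// divr_ge0. Qed.

Lemma schur_ge0 k x y : 0 <= schur k x y.
Proof.
by rewrite /schur; case: ifPn => // _; rewrite mule_ge0 ?walk_ge0// esum_ge0.
Qed.

(** For each class, superharmonicity bounds the sum over [y] of [W (2 * k) x y] times the weight
    ratio by [r ^+ (2 * k)]; the squares [v (theta x) c ^+ 2] add up to 1. *)
Lemma schur_row k x : Ebar x ->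
  \esum_(y in xsection R x) schur k x y <= (r ^+ (2 * k))%:E.
Proof.
move=> Ex; have Dx := EbarD Ex.
have rk0 : 0 <= (r ^+ (2 * k))%:E by rewrite lee_fin exprn_ge0// ltW.
rewrite -[leRHS]mule1 -(v1 (Dinv Dx (theta_inner.2 _ Dx)) (thetaE Ex)).
rewrite -esumZl//; last by move=> c _; rewrite lee_fin sqr_ge0.
apply: (@le_trans _ _ (\esum_(y in xsection R x)
  \esum_(c in classes_in Q2 Q1 (theta x))
    (W (2 * k) x y * (v (theta x) c ^+ 2 * (class_weight y c / class_weight x c))%:E))).
  by apply: le_esum => y _; rewrite /schur asboolT// esumZl ?walk_ge0.
rewrite exchange_esum; last by move=> y c _ _; rewrite mule_ge0 ?walk_ge0.
apply: le_esum => c Cc; have [z [Ez Dz Sxz cE]] := clsP Ex Cc.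
have [Rr _ _] := eqR; have cx0 := cw_gt0 Ex (Rr x) Cc.
pose a := (v (theta x) c ^+ 2 / class_weight x c)%R.
have a0 : 0 <= a%:E by rewrite lee_fin divr_ge0 ?sqr_ge0.
apply: (@le_trans _ _ (\esum_(y in xsection R x)
    a%:E * (W (2 * k) x y * (wgt y z)%:E))).
  apply: le_esum => y _; rewrite muleCA -EFinM /a [c in class_weight y c]cE cwE//.
  by rewrite [in leRHS]mulrAC -[in leRHS]mulrA.
rewrite esumZl//; last by move=> y _; rewrite mule_ge0 ?walk_ge0// lee_fin weight_ge0.
have Rxz : R (x, z) by exact: S2R'.
have wsup := weight_superharmonic eqR S1R Dinv p_sym r0 k Dx Rxz
  (green_ok Dz Ez Rxz).
apply: (le_trans (lee_wpmul2l a0 wsup)).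
rewrite -!EFinM lee_fin /a -(cwE x Ez) -cE.
by rewrite mulrCA -mulrA mulVf ?mulr1// gt_eqF.
Qed.

(** Related points have the same classes after applying [theta], and the walk is symmetric, so the
    inequality can be checked class by class: the difference is a square divided by the product of
    two positive weights. *)
Lemma schur_cross k x y : Ebar x -> S2 (x, y) ->
  W (2 * k) x y * (2%:E * \esum_(c in classes_in Q2 Q1 (theta x))
    (v (theta x) c * v (theta y) c)%:E) <= schur k x y + schur k y x.
Proof.
move=> Ex Sxy; have Dx := EbarD Ex; have Ey := EbarS Ex Sxy.
have [Sr Ss St] := eqS2; have Rxy := S2R' Sxy.
have clsxy : classes_in Q2 Q1 (theta y) = classes_in Q2 Q1 (theta x).
  rewrite /classes_in (@xsection_equiv _ Q2 (theta y) (theta x))//.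
  - by move=> a b [Sab [Ea Eb]]; split => //; exact: Ss.
  - by move=> a b c [Sab [Ea Eb]] [Sbc [_ Ec]]; split => //; exact: St Sbc.
  split; last by split; exact: thetaE.
  exact: St (Ss _ _ (thetaS Ey)) (St _ _ _ (Ss _ _ Sxy) (thetaS Ex)).
rewrite /schur !asboolT// clsxy -(W_sym _ Dx Rxy).
rewrite -ge0_muleDr ?esum_ge0// lee_wpmul2l ?walk_ge0//.
rewrite -esumD// -esumZl//; last by move=> c _; rewrite lee_fin mulr_ge0.
apply: le_esum => c Cc; rewrite -EFinM -EFinD lee_fin.
have [Rr _ _] := eqR; have cx0 := cw_gt0 Ex (Rr x) Cc; have cy0 := cw_gt0 Ex Rxy Cc.
set p := v _ _; set q := v _ _; set a := class_weight y c; set b := class_weight x c.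
rewrite -subr_ge0.
have -> : (p ^+ 2 * (a / b) + q ^+ 2 * (b / a) - 2 * (p * q) =
    (p * a - q * b) ^+ 2 / (a * b))%R.
  by field; rewrite !gt_eqF.
by rewrite divr_ge0 ?sqr_ge0// mulr_ge0// ltW.
Qed.

Lemma schur_measurable k : borel_kernel R D (schur k).
Proof.
move=> f h fi hi; have mD := enum_measurable enumD.
have mf : measurable (D `&` [set t | Ebar (f t)]).
  exact: (measurable_setI_fun enumD fi.1 mEbar).
apply: measurable_fun_ifprop => //.
apply: emeasurable_funM.
  exact: (measurable_walk sepB hnu hrep enumD).
have tfi : inner_map R D (theta \o f) by exact: (inner_map_comp enumD).
apply: (measurable_classes_sum enumD mE S2R S12 (f := 
  theta \o f) (G := fun t c => (v (theta (f t)) c ^+ 2 *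
    (class_weight (h t) c / class_weight (f t) c))%:E)) => // i.
have gfi : inner_map R D (g i \o (theta \o f)).
  by apply: (inner_map_comp enumD) => //; exact: (inner_map_g enumD).
apply/measurable_EFinP.
apply: (eq_measurable_fun (fun t =>
  (v ((theta \o f) t) (xsection Q1 ((g i \o (theta \o f)) t)) ^+ 2 *
   (wgt (h t) (g i (theta (f t))) / wgt (f t) (g i (theta (f t)))))%R)).
  by move=> t /[!inE] -[Dt [/= _ [_ Eg]]]; rewrite !cwE.
apply: measurable_funM; first exact: mv.
apply: measurable_funS (measurable_ratio sepB hnu hrep enumD subS1R r0 fi hi gfi) => //.
Qed.

(** Mass transport shows that the two halves have the same integral, and [schur_row] bounds one of
    them; [mu D] is at most 1. *)
Lemma schur_integral k :
  \int[mu]_(x in D) (\esum_(y in xsection R x) schur k x y +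
                     \esum_(y in xsection R x) schur k y x) <=
  (2 * r ^+ (2 * k))%:E.
Proof.
have mD := enum_measurable enumD; have msch := schur_measurable k.
have rk0 : 0 <= (r ^+ (2 * k))%:E by rewrite lee_fin exprn_ge0// ltW.
have idi := inner_map_id enumD; have gi i := inner_map_g enumD i.
rewrite ge0_integralD//; first last.
- by apply: (measurable_class_sum sepB enumD) => [*|i]; [exact: schur_ge0|exact: msch].
- by move=> x _; apply: esum_ge0 => y _; exact: schur_ge0.
- by apply: (measurable_class_sum sepB enumD) => [*|i]; [exact: schur_ge0|exact: msch].
- by move=> x _; apply: esum_ge0 => y _; exact: schur_ge0.
have MT := enumerated_mass_transport (F := schur k) sepB hR enumD
  (fun i => msch _ _ idi (gi i)) (fun x y _ _ => schur_ge0 k x y).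
have -> : (2 * r ^+ (2 * k))%:E = (r ^+ (2 * k))%:E + (r ^+ (2 * k))%:E.
  by rewrite mulr_natl mulr2n EFinD.
suff le : \int[mu]_(x in D) (\esum_(y in xsection R x) schur k x y) <=
    (r ^+ (2 * k))%:E.
  by apply: leeD; [exact: le|rewrite -MT; exact: le].
apply: (@le_trans _ _ (\int[mu]_(x in D) (r ^+ (2 * k))%:E)).
  apply: le_lower_integral => x Dx; first by apply: esum_ge0 => y _; exact: schur_ge0.
  have [Ex|nEx] := pselect (Ebar x); first exact: (schur_row k Ex).
  rewrite esum1; first exact: rk0.
  by move=> y _; rewrite /schur asboolF.
move: ((r ^+ (2 * k))%:E) rk0 => c c0.
have muD : mu D <= 1 by exact: probability_le1.
have muc : c * mu D <= c * 1 by exact: lee_wpmul2l.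
rewrite mule1 in muc.
apply: le_trans muc.
have -> : \int[mu]_(x in D) c = c * mu D by exact: integral_cst.
exact: lexx.
Qed.

End schur.

(** * Almost invariant vectors *)

Lemma le_limn_einf (K : realType) (c : K) (u e : nat -> \bar K) :
  (forall n, c%:E <= u n + e n) -> e @ \oo --> 0 -> c%:E <= limn_einf u.
Proof.
move=> ue e0; apply/lee_addgt0Pr => eps eps0; rewrite -leeBlDr//.
have /e0[N _ eN] : nbhs (0 : \bar K) (fun y => y < eps%:E).
  by apply: open_ereal_lt'; rewrite lte_fin.
have le1 : c%:E - eps%:E <= einfs u N.
  apply: le_ereal_inf_tmp => _ [n Nn <-].
  rewrite leeBlDr//; apply: le_trans (ue n) _; rewrite leeD2l// ltW//.
  exact: eN.
apply: (le_trans le1); rewrite limn_einf_lim (cvg_lim _ (@cvg_einfs_sup _ u))//.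
by apply: ereal_sup_ubound; exists N.
Qed.

(** Passing to moduli preserves almost invariance: the real part of [a] times the conjugate of [b]
    is at most the product of the moduli, by Cauchy-Schwarz in the plane. *)
Lemma normc_cross (K : realType) (a b : K[i]) :
  (ComplexField.Normc.normc a ^+ 2 + ComplexField.Normc.normc b ^+ 2 <=
   2 * (ComplexField.Normc.normc a * ComplexField.Normc.normc b) +
   ComplexField.Normc.normc (a - b) ^+ 2)%R.
Proof.
rewrite !normc_sqrE; case: a b => [x y] [u v] /=.
rewrite -sqrtrM ?addr_ge0 ?sqr_ge0//.
set s := Num.sqrt _.
suff : (x * u + y * v <= s)%R.
  rewrite -subr_ge0 => H; rewrite -subr_ge0.
  rewrite (_ : _ - _ = 2 * (s - (x * u + y * v)))%R; last by ring.
  by rewrite mulr_ge0.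
apply: (le_trans (ler_norm _)); rewrite -sqrtr_sqr ler_wsqrtr// -subr_ge0.
rewrite (_ : _ - _ = (x * v - y * u) ^+ 2)%R; last by ring.
exact: sqr_ge0.
Qed.

Lemma ell2_norm_sqr (K : realType) d (X : measurableType d) (C : set (set X))
    (f : set X -> K[i]) :
  \esum_(c in C) ((ComplexField.Normc.normc (f c)) ^+ 2)%:E =
  ell2_norm C f * ell2_norm C f.
Proof.
rewrite /ell2_norm; set s := esum _ _.
have : 0 <= s by apply: esum_ge0 => c _; rewrite lee_fin sqr_ge0.
case: s => [t| |]//.
  by rewrite lee_fin => t0; rewrite poweR_EFin powR12_sqrt// -EFinM -expr2 sqr_sqrtr.
by rewrite poweRyr// invr_neq0.
Qed.

Section schur_limit.
Context (K : realType) d (X : measurableType d) (B : nat -> set X)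
  (mu : probability X K) (R S1 S2 : set (X * X))
  (nu : probability (fg_type X) K) (rep : set (X -> X) -> X -> X)
  (D : set X) (g : nat -> X -> X) (E : set X) (r : K).
Hypotheses (sepB : separating B) (hR : discrete_pmp mu R)
  (hnu : countably_supported mu R nu) (hsym : symmetric_law mu R nu)
  (hrep : representatives mu R rep)
  (enumD : enumerated R D g) (repD : rep_inverse_on mu R nu rep D)
  (walkD : forall x i, D x -> exists j, 0 < walk R nu rep j x (g i x))
  (mE : measurable E) (S2R : subrelation S2 R) (S12 : subrelation S1 S2)
  (r0 : (0 < r)%R).
Local Notation Q1 := (restrict_rel E S1).
Local Notation Q2 := (restrict_rel E S2).
Local Notation W := (walk R nu rep).
Hypothesis green_E : forall z, D z -> E z -> green R S1 nu rep r 0 z z < +oo.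

Variables (Ebar : set X) (theta : X -> X).
Hypotheses (mEbar : measurable Ebar) (EbarD : Ebar `<=` D)
  (theta_inner : inner_map R D theta)
  (thetaE : forall x, Ebar x -> E (theta x))
  (thetaS : forall x, Ebar x -> S2 (x, theta x))
  (EbarS : forall x y, Ebar x -> S2 (x, y) -> Ebar y).

Variables (m : {measure set X -> \bar K}) (xi : nat -> X * set X -> K[i]).
Hypotheses (L2xi : forall n, @L2 K d X E m Q2 Q1 (xi n))
  (xi1 : forall n x, D x -> E x ->
    ell2_norm (classes_in Q2 Q1 x) (fun c => xi n (x, c)) = 1)
  (xi_inv : forall x y, D x -> Q2 (x, y) ->
    ell2_norm (classes_in Q2 Q1 x) (fun c => xi n (x, c) - xi n (y, c))%R
      @[n --> \oo] --> 0).

Let v n x c : K := ComplexField.Normc.normc (xi n (x, c)).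
Let T k n x :=
  \esum_(y in xsection R x) schur R S1 S2 nu rep E r Ebar theta (v n) k x y +
  \esum_(y in xsection R x) schur R S1 S2 nu rep E r Ebar theta (v n) k y x.

Let v0 n x c : (0 <= v n x c)%R.
Proof. by rewrite /v; case: (xi n _) => a b; exact: sqrtr_ge0. Qed.

Let v1 n x : D x -> E x -> \esum_(c in classes_in Q2 Q1 x) (v n x c ^+ 2)%:E = 1.
Proof.
by move=> Dx Ex; rewrite (ell2_norm_sqr _ (fun c => xi n (x, c))) xi1// mule1.
Qed.

Let mv n f h : inner_map R D f -> inner_map R D h ->
  measurable_fun (D `&` [set t | Q2 (f t, h t)])
    (fun t => (v n (f t) (xsection Q1 (h t)) ^+ 2)%R).
Proof.
by move=> fi hi; exact: (L2_kernel_measurable sepB enumD mE S2R S12 (L2xi n) fi hi).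
Qed.

Let T_ge0 k n x : 0 <= T k n x.
Proof.
by apply: adde_ge0; apply: esum_ge0 => y _; apply: schur_ge0.
Qed.

Let delta n x y : \bar K := \esum_(c in classes_in Q2 Q1 (theta x))
  (ComplexField.Normc.normc (xi n (theta x, c) - xi n (theta y, c)) ^+ 2)%:E.

Let delta_ge0 n x y : 0 <= delta n x y.
Proof. by apply: esum_ge0 => c _; rewrite lee_fin sqr_ge0. Qed.

Let thetaQ x y : Ebar x -> S2 (x, y) -> Q2 (theta x, theta y).
Proof.
move=> Ex Sxy; have Ey := EbarS Ex Sxy.
have [_ [_ Ss St] _] := S2R; split; last by split; exact: thetaE.
exact: St (Ss _ _ (thetaS Ex)) (St _ _ _ Sxy (thetaS Ey)).
Qed.

Let theta_cls x y : Ebar x -> S2 (x, y) ->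
  classes_in Q2 Q1 (theta x) = classes_in Q2 Q1 (theta y).
Proof.
move=> Ex Sxy; have [_ [_ Ss St] _] := S2R.
rewrite /classes_in (@xsection_equiv _ Q2 (theta x) (theta y))//.
- by move=> a b [Sab [Ea Eb]]; split => //; exact: Ss.
- by move=> a b c [Sab [Ea Eb]] [Sbc [_ Ec]]; split => //; exact: St Sbc.
- exact: thetaQ.
Qed.

Let DE x : Ebar x -> D (theta x) /\ E (theta x).
Proof.
move=> Ex; split; last exact: thetaE.
by apply: enum_invariant enumD _ _ (EbarD Ex) _; apply: theta_inner.2; exact: EbarD.
Qed.

Let delta_cvg x y : Ebar x -> S2 (x, y) -> delta n x y @[n --> \oo] --> 0.
Proof.
move=> Ex Sxy; have [Dx _] := DE Ex.
have L := xi_inv Dx (thetaQ Ex Sxy).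
have -> : (fun n => delta n x y) = (fun n =>
    ell2_norm (classes_in Q2 Q1 (theta x))
      (fun c => xi n (theta x, c) - xi n (theta y, c))%R *
    ell2_norm (classes_in Q2 Q1 (theta x))
      (fun c => xi n (theta x, c) - xi n (theta y, c))%R).
  by apply/funext => n; rewrite -ell2_norm_sqr.
by rewrite -[X in _ --> X](mule0 0); apply: cvgeM.
Qed.

(** The constant 2 is the sum of the squared norms of the two unit vectors at [theta x] and
    [theta y], and [delta] is their squared distance. *)
Let cross_ge2 n x y : Ebar x -> S2 (x, y) ->
  2%:E <= 2%:E * (\esum_(c in classes_in Q2 Q1 (theta x))
    (v n (theta x) c * v n (theta y) c)%:E) + delta n x y.
Proof.
move=> Ex Sxy; have Ey := EbarS Ex Sxy.
have [Dx' Ex'] := DE Ex; have [Dy' Ey'] := DE Ey.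
have two : 2%:E = \esum_(c in classes_in Q2 Q1 (theta x)) (v n (theta x) c ^+ 2)%:E +
    \esum_(c in classes_in Q2 Q1 (theta x)) (v n (theta y) c ^+ 2)%:E.
  by rewrite [in X in _ + X](theta_cls Ex Sxy) !v1.
rewrite [leLHS]two -esumZl//; last by move=> c _; rewrite lee_fin mulr_ge0.
rewrite -!esumD//; last 4 first.
- by move=> c _; rewrite mule_ge0// lee_fin mulr_ge0.
- by move=> c _; rewrite lee_fin sqr_ge0.
- by move=> c _; rewrite lee_fin sqr_ge0.
- by move=> c _; rewrite lee_fin sqr_ge0.
apply: le_esum => c _; rewrite -EFinM -!EFinD lee_fin.
exact: normc_cross.
Qed.

(** Convergence of [delta n x y] is not uniform in [y]. It suffices to bound the sums over finite
    subsets [Y] of the class, for which the error, a finite sum of terms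
    [W (2 * k) x y * delta n x y], tends to 0. *)
Let T_liminf k x : Ebar x ->
  2%:E * hit R S2 nu rep (2 * k) x x <= limn_einf (fun n => T k n x).
Proof.
move=> Ex; have Dx := EbarD Ex; have [_ [Sr _ _] S2subR] := S2R.
rewrite /hit -esumZl//; last by move=> y _; exact: walk_ge0.
apply: ge_ereal_sup => _ [Y [finY YS] <-].
have Wf y : S2 (x, y) -> W (2 * k) x y \is a fin_num.
  move=> Sxy; apply: (walk_fin (D := D)) => //; last exact: S2subR.
  - by case: enumD.
  - by move=> a b; exact: enum_invariant enumD a b.
  - by move=> a _; exact: transition_le1.
have cf : \sum_(y \in Y) (2%:E * W (2 * k) x y) \is a fin_num.
  rewrite fsbig_finite//= big_seq; apply/sum_fin_numP => y.
  rewrite in_fset_set// inE => /YS/xsectionP Sxy _.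
  by rewrite fin_numM// Wf.
rewrite -(fineK cf).
apply: (@le_limn_einf _ _ _ (fun n => \sum_(y \in Y) (W (2 * k) x y * delta n x y))).
  move=> n; rewrite fineK//.
  apply: (@le_trans _ _ (\sum_(y \in Y)
     (schur R S1 S2 nu rep E r Ebar theta (v n) k x y +
      schur R S1 S2 nu rep E r Ebar theta (v n) k y x) +
     \sum_(y \in Y) (W (2 * k) x y * delta n x y))).
    rewrite -fsbig_split//=; apply: lee_fsum => // y /YS/xsectionP Sxy.
    have := @schur_cross _ _ _ _ _ _ _ _ _ _ _ _ _ hnu hsym hrep enumD repD walkD
      S2R S12 r0 green_E _ _ EbarD thetaE thetaS EbarS (v n) (v0 n) k x y Ex Sxy.
    move=> /(leeD2r (W (2 * k) x y * delta n x y)); apply: le_trans.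
    rewrite -ge0_muleDr//; last first.
      by rewrite mule_ge0//; apply: esum_ge0 => c _; rewrite lee_fin mulr_ge0.
    by rewrite muleC lee_wpmul2l ?walk_ge0//; exact: cross_ge2.
  apply: leeD => //; rewrite /T -esumD; last 2 first.
  - by move=> y _; exact: schur_ge0.
  - by move=> y _; exact: schur_ge0.
  apply: esum_ge; exists Y => //; split => // y /YS /xsectionP Sxy.
  by apply/xsectionP; exact: S2subR.
have -> : (fun n => \sum_(y \in Y) (W (2 * k) x y * delta n x y)) =
    (fun n => (\sum_(y <- fset_set Y | y \in fset_set Y)
      (W (2 * k) x y * delta n x y)%E)%R).
  by apply/funext => n; rewrite fsbig_finite//= big_seq.
have S0 : (\sum_(y <- fset_set Y | y \in fset_set Y) (0 : \bar K))%R = 0.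
  by rewrite big1.
rewrite -[X in _ --> X]S0.
apply: cvg_nnesum => y; rewrite in_fset_set// inE => /YS/xsectionP Sxy.
  by apply: nearW => n; rewrite mule_ge0 ?walk_ge0.
rewrite -(mule0 (W (2 * k) x y)); apply: cvgeZl; first exact: Wf.
exact: delta_cvg.
Qed.

Lemma hit_integral_le k :
  \int[mu]_(x in Ebar) (2%:E * hit R S2 nu rep (2 * k) x x) <=
  (2 * r ^+ (2 * k))%:E.
Proof.
have mD := enum_measurable enumD.
have mT n : measurable_fun D (T k n).
  have msch := schur_measurable sepB hnu hrep enumD mE S2R S12 r0 mEbar
    theta_inner (mv n) k.
  have idi := inner_map_id enumD; have gi i := inner_map_g enumD i.
  apply: emeasurable_funD.
    by apply: (measurable_class_sum sepB enumD) => [*|i]; [exact: schur_ge0|exact: msch].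
  by apply: (measurable_class_sum sepB enumD) => [*|i]; [exact: schur_ge0|exact: msch].
have DE' : Ebar = D `&` Ebar.
  by apply/seteqP; split => [x Ex|x []//]; split => //; exact: EbarD.
(* The integral is extended to the invariant set [D], where [schur_integral] applies; off [Ebar] the
   integrand is 0 and [T] is nonnegative. *)
rewrite [in leLHS]DE' integral_mkcondr.
apply: (@le_trans _ _ (\int[mu]_(x in D) limn_einf (fun n => T k n x))).
  apply: le_lower_integral => x Dx; rewrite patchE.
    by case: ifPn => // _; rewrite mule_ge0 ?hit_ge0.
  case: ifPn => [/set_mem Ex|_]; first exact: T_liminf.
  apply: (@le_limn_einf _ 0 _ (cst 0)) => [n|]; last exact: cvg_cst.
  by rewrite adde0.
apply: le_trans (fatou mu mD mT _) _ => //.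
rewrite limn_einf_lim; apply: lime_le; first exact: is_cvg_einfs.
apply: nearW => n; apply: (@le_trans _ _ (\int[mu]_(x in D) T k n x)).
  by apply: ereal_inf_lbound; exists n => /=.
exact: (schur_integral sepB hR hnu hsym hrep enumD repD walkD mE S2R S12 r0 green_E
  mEbar EbarD theta_inner thetaE thetaS (v1 n) (mv n) k).
Qed.

End schur_limit.

Lemma nneseries_geometric_le (K : realType) (c q : K) :
  (0 <= c)%R -> (0 <= q < 1)%R ->
  \sum_(0 <= k <oo) (c * q ^+ k)%:E <= (c / (1 - q))%:E.
Proof.
move=> c0 /andP[q0 q1]; have q1' : (0 < 1 - q)%R by rewrite subr_gt0.
apply: lime_le.
  by apply: is_cvg_nneseries => k _ _; rewrite lee_fin mulr_ge0 ?exprn_ge0.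
apply: nearW => n; suff -> : \sum_(0 <= k < n) (c * q ^+ k)%:E =
    (c / (1 - q) * (1 - q ^+ n))%:E.
  rewrite lee_fin ler_piMr//; first by rewrite divr_ge0// ltW.
  by rewrite gerBl exprn_ge0.
elim: n => [|n IH]; first by rewrite big_nil expr0 subrr mulr0.
rewrite big_nat_recr//= IH -EFinD exprS; congr (_%:E).
by field; rewrite gt_eqF.
Qed.

(** * Moving points into [E], and null sets for the measure restricted to [E] *)

Section retraction.
Context d (X : measurableType d) (R S : set (X * X)) (D : set X)
  (g : nat -> X -> X) (E : set X).
Hypotheses (enumD : enumerated R D g) (mE : measurable E) (SR : subrelation S R).

(** The map [theta] sends [x] to the first [g i x] that lies in [E] and in the [S]-class of [x]; the
    disjoint sets [U i] record this first index. Outside [Ebar] it is the identity. *)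
Lemma class_retraction : exists Ebar theta,
  [/\ [/\ measurable Ebar, Ebar `<=` D & D `&` E `<=` Ebar],
      inner_map R D theta,
      forall x, Ebar x -> E (theta x),
      forall x, Ebar x -> S (x, theta x) &
      forall x y, Ebar x -> S (x, y) -> Ebar y].
Proof.
have [mD [Rr Rs Rt] Dinv mg orb] := enumD.
have [mS [Sr Ss St] SsubR] := SR.
pose V i := D `&` ([set x | S (x, g i x)] `&` g i @^-1` E).
have mV i : measurable (V i).
  apply: measurableI => //; apply: measurableI.
    exact: (measurable_rel mS (@measurable_id _ _ setT) (mg i)).
  by rewrite -[X in measurable X]setTI; exact: mg.
pose U := seqDU V.
have mU i : measurable (U i) by exact: seqDU_measurable.
pose Ebar := \bigcup_i V i.
have EbarU : Ebar = \bigcup_i U i by exact: seqDU_bigcup_eq.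
pose idx x := xget 0%N [set i | U i x].
pose theta x := if `[< Ebar x >] then g (idx x) x else x.
have idxU x : Ebar x -> U (idx x) x.
  rewrite EbarU => -[i _ Uix]; rewrite /idx; case: xgetP => // /(_ i).
  by [].
have idxE i x : U i x -> idx x = i.
  move=> Uix; have Ex : Ebar x by rewrite EbarU; exists i.
  apply: (@trivIset_seqDU _ V (idx x) i I I).
  by exists x; split; [exact: idxU|].
have idxV x : Ebar x -> V (idx x) x by move/idxU => -[].
have thE x : Ebar x -> theta x = g (idx x) x by move=> Ex; rewrite /theta asboolT.
have mEbar : measurable Ebar by exact: bigcupT_measurable.
have mtheta : measurable_fun setT theta.
  move=> _ Y mY; rewrite setTI.
  rewrite (_ : theta @^-1` Y =
    (\bigcup_i (U i `&` g i @^-1` Y)) `|` (~` Ebar `&` Y)).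
    apply: measurableU; last by apply: measurableI => //; exact: measurableC.
    apply: bigcupT_measurable => i; apply: measurableI => //.
    by rewrite -[X in measurable X]setTI; exact: mg.
  apply/seteqP; split => [x|x [[i _ [Uix Yx]]|[nEx Yx]]]; rewrite /preimage/=.
  - have [Ex|nEx] := pselect (Ebar x).
      by rewrite thE// => Yx; left; exists (idx x) => //; split => //; exact: idxU.
    by rewrite /theta asboolF// => Yx; right.
  - have Ex : Ebar x by rewrite EbarU; exists i.
    by rewrite thE// (idxE _ _ Uix).
  - by rewrite /theta asboolF.
exists Ebar, theta; split.
- split => //; first by move=> x [i _ []].
  move=> x [Dx Ex]; have : xsection R x x by exact/xsectionP.
  rewrite orb// => -[i _ gi]; exists i => //; split => //.
  by rewrite /preimage/= gi; split.
- split => // x Dx; have [Ex|nEx] := pselect (Ebar x).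
    by rewrite thE//; apply: SsubR; have [_ []] := idxV _ Ex.
  by rewrite /theta asboolF.
- by move=> x Ex; rewrite thE//; have [_ []] := idxV _ Ex.
- by move=> x Ex; rewrite thE//; have [_ []] := idxV _ Ex.
- move=> x y [i _ [Dx [/= Sx Ex]]] Sxy.
  have Dy : D y by apply: Dinv Dx _; exact: SsubR.
  have Sy : S (y, g i x) by exact: St (Ss _ _ Sxy) Sx.
  have : xsection R y (g i x) by apply/xsectionP; exact: SsubR.
  rewrite orb// => -[j _ gj]; exists j => //; split => //.
  by rewrite /preimage/= gj.
Qed.

End retraction.

Section normalized_restriction.
Context (K : realType) d (X : measurableType d) (mu : probability X K)
  (E : set X) (mE : measurable E).
Hypothesis E0 : 0 < mu E.
Local Notation m := (mnormalize (mrestr mu mE) mu).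

Lemma mnormalize_restr_null (A : set X) : m A = 0 -> mu (A `&` E) = 0.
Proof.
have Efin : mu E < +oo by apply: le_lt_trans (ltry 1); exact: probability_le1.
rewrite /mnormalize/= /mrestr setTI gt_eqF// lt_eqF//= => /eqP.
rewrite mule_eq0 => /orP[/eqP//|]; rewrite eqe invr_eq0 fine_eq0.
  by rewrite gt_eqF.
by rewrite ge0_fin_numE// ltW.
Qed.

Lemma mnormalize_restr_negligible (A : set X) :
  (m : set X -> \bar K).-negligible A -> A `<=` E -> mu.-negligible A.
Proof.
move=> [A' [mA' A'0 AA']] AE; exists (A' `&` E); split.
- exact: measurableI.
- exact: mnormalize_restr_null.
- by move=> x Ax; split; [exact: AA'|exact: AE].
Qed.

(** Turns a statement about almost every pair into one about almost every point, along the graph of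
    a single map. A point whose pair lies in the exceptional set contributes at least 1 to the
    counting integral. *)
Lemma rel_measure_negligible (Q : set (X * X)) (P : X * X -> Prop) (g : X -> X) :
  measurable Q -> Q `<=` E `*` E -> measurable_fun setT g ->
  {ae rel_measure E m Q, forall p, Q p -> P p} ->
  mu.-negligible [set x | Q (x, g x) /\ ~ P (x, g x)].
Proof.
move=> mQ QE mg [A [mA A0 PA]].
pose Z := [set x | (A `&` Q) (x, g x)].
have mZ : measurable Z.
  by apply: (measurable_rel _ (@measurable_id _ _ setT) mg); exact: measurableI.
have ZE : Z `<=` E by move=> x [_ /QE[]].
exists Z; split => //; last first.
  by move=> x [Qx nP]; split => //; apply: PA => H; apply: nP; exact: H.
have mZ0 : m Z = 0.
  apply/eqP; rewrite -measure_le0 -A0 /rel_measure.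
  apply: (@le_trans _ _ (\int[m]_(x in E) (\1_Z x)%:E)).
    by rewrite integral_indic// setIidl.
  apply: le_lower_integral => x Ex; first by rewrite lee_fin.
  rewrite indicE; case: (boolP (x \in Z)) => [/set_mem Zx|_].
    rewrite /counting; case: ifPn => [/asboolP fin|_]; last by rewrite leey.
    rewrite lee_fin ler1n cardfs_gt0; apply/fset0Pn; exists (g x).
    by rewrite in_fset_set// inE; exact/xsectionP.
  rewrite /counting; case: ifPn => _; last by rewrite leey.
  by rewrite lee_fin.
by rewrite -(setIidl ZE); exact: mnormalize_restr_null.
Qed.

End normalized_restriction.

(** * Comparison of the two radii *)

Section transfer.
Context (K : realType) d (X : measurableType d) (B : nat -> set X)
  (mu : probability X K) (R S1 S2 : set (X * X))
  (nu : probability (fg_type X) K) (rep : set (X -> X) -> X -> X).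
Hypotheses (sepB : separating B) (hR : discrete_pmp mu R)
  (hnu : countably_supported mu R nu) (hsym : symmetric_law mu R nu)
  (hrep : representatives mu R rep) (hgen : generates mu R nu rep)
  (S2R : subrelation S2 R) (S12 : subrelation S1 S2)
  (hco : everywhere_coamenable mu S2 S1).

(** Weighted by [r' ^- (2 * k)], the bounds of [hit_integral_le] form a convergent geometric series
    of ratio [(r / r') ^+ 2]. Hence the Green function of [S2] at [r'] is integrable over [Ebar],
    and so finite almost everywhere there. *)
Lemma green_transfer r r' : (0 < r)%R -> (r < r')%R ->
  {ae mu, forall x, green R S1 nu rep r 0 x x < +oo ->
                    green R S2 nu rep r' 0 x x < +oo}.
Proof.
move=> r0 rr'; have r'0 := lt_trans r0 rr'.
have S1R : subrelation S1 R.
  have [? ? s12] := S12; have [_ _ s2R] := S2R; split => //.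
  exact: subset_trans s12 s2R.
have [mS1 _ _] := S12; have [mS2 [S2r S2s S2t] S2subR] := S2R.
have [D0 [g [enumD0 D00 _ repD0 walkD0]]] :=
  walk_setup sepB hR hnu hsym hrep hgen (@negligible_set0 _ _ _ mu).
have mD0 := enum_measurable enumD0.
pose E := D0 `&` [set x | green R S1 nu rep r 0 x x < +oo].
have mE : measurable E.
  have id0 := inner_map_id enumD0.
  have := measurable_green sepB hnu hrep enumD0 S1R r0 0 id0 id0.
  move=> /(_ mD0 _ (emeasurable_itv (Interval -oo%O (BLeft +oo)))).
  congr (measurable (_ `&` _)).
have negD0 : mu.-negligible (~` D0).
  by apply/negligibleP => //; exact: measurableC.
have [E0|E0] := eqVneq (mu E) 0.
  have negE : mu.-negligible E by apply/negligibleP.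
  suff sub : ~` [set x | green R S1 nu rep r 0 x x < +oo ->
      green R S2 nu rep r' 0 x x < +oo] `<=` ~` D0 `|` E.
    exact: (negligibleS sub (negligibleU negD0 negE)).
  move=> x /= H; have [Dx|] := pselect (D0 x); last by left.
  by right; split => //; apply: contrapT => nx; apply: H.
have {}E0 : 0 < mu E by rewrite lt_neqAle eq_sym E0/=.
have [xi [L2xi xi1 xi_inv]] := hco mE E0.
pose N1 n := [set x | ~ (E x ->
  ell2_norm (classes_in (restrict_rel E S2) (restrict_rel E S1) x)
    (fun c => xi n (x, c)) = 1)].
pose P p := ell2_norm (classes_in (restrict_rel E S2) (restrict_rel E S1) p.1)
  (fun c => xi n (p.1, c) - xi n (p.2, c))%R @[n --> \oo] --> 0.
pose N2 i := [set x | restrict_rel E S2 (x, g i x) /\ ~ P (x, g i x)].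
have negN : mu.-negligible (~` D0 `|` (\bigcup_n N1 n `|` \bigcup_i N2 i)).
  apply: negligibleU => //; apply: negligibleU; apply: negligible_bigcup => n.
    apply: (mnormalize_restr_negligible E0 (xi1 n)) => x /not_implyP[] //.
  apply: (rel_measure_negligible (mE := mE) (P := P) E0 _ _ _ xi_inv).
  - exact: restrict_rel_measurable.
  - by move=> p [].
  - exact: enum_fun enumD0 n.
have [M [mM M0 NM]] := negN.
have MD0 x : ~ M x -> D0 x.
  by move=> Mx; apply: contrapT => Dx; apply: Mx; apply: NM; left.
(* A second conull set is needed: the vectors [xi] depend on [E], hence on [D0], and their own
   exceptional sets can be removed only now. *)
have [D enumD [DM0 DM]] := enumerated_avoid_null sepB hR mM M0 (enum_fun enumD0)
  (fun x Mx => enum_orbit enumD0 (MD0 x Mx)).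
have DD0 x : D x -> D0 x by move/DM/MD0.
have mD := enum_measurable enumD.
have repD : rep_inverse_on mu R nu rep D by move=> c x sc /DD0; exact: repD0.
have walkD x i : D x -> exists j, 0 < walk R nu rep j x (g i x).
  by move/DD0; exact: walkD0.
have green_E z : D z -> E z -> green R S1 nu rep r 0 z z < +oo by move=> _ [].
have xi1' n x : D x -> E x -> ell2_norm (classes_in (restrict_rel E S2)
    (restrict_rel E S1) x) (fun c => xi n (x, c)) = 1.
  move=> Dx; apply: contrapT => H; apply: (DM _ Dx); apply: NM; right; left.
  by exists n.
have xi_inv' x y : D x -> restrict_rel E S2 (x, y) -> P (x, y).
  move=> Dx Qxy; have : xsection R x y by apply/xsectionP/S2subR; case: Qxy.
  rewrite (enum_orbit enumD Dx) => -[i _ gi]; rewrite -gi in Qxy *.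
  apply: contrapT => H; apply: (DM _ Dx); apply: NM; right; right.
  by exists i.
have [Ebar [theta [[mEbar EbarD DEbar] thi thE thS EbS]]] :=
  class_retraction enumD mE S2R.
have bound k := hit_integral_le sepB hR hnu hsym hrep enumD repD walkD mE S2R S12
  r0 green_E mEbar EbarD thi thE thS EbS L2xi xi1' xi_inv' k.
(* The factor 2 is kept to match [hit_integral_le]; it is dropped in the final comparison with
   [green]. *)
pose f k x := (r' ^- (2 * k))%:E * (2%:E * hit R S2 nu rep (2 * k) x x).
have c0 k : (0 <= r' ^- (2 * k))%R by rewrite invr_ge0 exprn_ge0// ltW.
have f0 k x : 0 <= f k x by rewrite /f !mule_ge0 ?hit_ge0 ?lee_fin.
have mh k : measurable_fun Ebar (fun x => 2%:E * hit R S2 nu rep (2 * k) x x).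
  apply: measurable_funeM; apply: (measurable_funS mD EbarD).
  have idi := inner_map_id enumD.
  exact: (measurable_hit sepB hnu hrep enumD S2R (2 * k) idi idi).
have mf k : measurable_fun Ebar (f k) by exact: measurable_funeM.
have q01 : (0 <= (r / r') ^+ 2 < 1)%R.
  rewrite sqr_ge0/= expr_lt1 ?divr_ge0 ?ltW//.
  by rewrite ltr_pdivrMr// mul1r.
have int_fin : \int[mu]_(x in Ebar) (\sum_(0 <= k <oo) f k x) < +oo.
  rewrite integral_nneseries//.
  apply: (@le_lt_trans _ _ (2 / (1 - (r / r') ^+ 2))%:E); last exact: ltry.
  apply: le_trans (nneseries_geometric_le _ q01) => //.
  apply: lee_nneseries => [k _ _|k _]; first by apply: integral_ge0 => x _; exact: f0.
  rewrite /f ge0_integralZl_EFin//; last by move=> x _; rewrite mule_ge0 ?hit_ge0.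
  have ck : 0 <= (r' ^- (2 * k))%:E by rewrite lee_fin.
  apply: (le_trans (lee_wpmul2l ck (bound k))).
  by rewrite -EFinM lee_fin -exprM expr_div_n mulrCA (mulrC (r' ^- _))%R.
have msum : measurable_fun Ebar (fun x => \sum_(0 <= k <oo) f k x).
  exact: measurable_nneseries.
have ae_fin : {ae mu, forall x, Ebar x -> \sum_(0 <= k <oo) f k x \is a fin_num}.
  apply: integrable_ae => //; apply/integrableP; split => //.
  rewrite (eq_integral (fun x => \sum_(0 <= k <oo) f k x)) // => x _.
  by rewrite gee0_abs// nneseries_ge0.
have negD : mu.-negligible (~` D).
  by apply/negligibleP => //; exact: measurableC.
suff sub : ~` [set x | green R S1 nu rep r 0 x x < +oo ->
      green R S2 nu rep r' 0 x x < +oo] `<=`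
    ~` D `|` ~` [set x | Ebar x -> \sum_(0 <= k <oo) f k x \is a fin_num].
  exact: (negligibleS sub (negligibleU negD ae_fin)).
move=> x /= H.
have [Dx|] := pselect (D x); last by left.
right => fin; apply: H => gx.
have /fin : Ebar x by apply: DEbar; split => //; split => //; exact: DD0.
move=> ffin; apply: (@le_lt_trans _ _ (\sum_(0 <= k <oo) f k x)).
  rewrite /green -nneseries_esumT; last first.
    by move=> k; rewrite mule_ge0 ?hit_ge0 ?lee_fin.
  apply: lee_nneseries => [k _ _|k _]; first by rewrite mule_ge0 ?hit_ge0 ?lee_fin.
  rewrite /f addn0 lee_wpmul2l ?lee_fin//.
  rewrite -[leLHS]mul1e lee_wpmul2r ?hit_ge0// lee_fin.
  by rewrite ler1n.
by rewrite -ge0_fin_numE// nneseries_ge0.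
Qed.

End transfer.

(** * Root test and conclusion *)

Section root_test.
Context (K : realType) (p : nat -> K) (rho r : K).
Hypotheses (p0 : forall k, (0 <= p k)%R) (r0 : (0 < r)%R)
  (p_rho : (p k `^ (2 * k)%:R^-1)%R @[k --> \oo] --> rho).
Local Notation t k := (r ^- (2 * k) * p k)%R.

Let root_pow k : (0 < k)%N -> ((p k `^ (2 * k)%:R^-1) ^+ (2 * k) = p k)%R.
Proof.
move=> k0; rewrite -powR_mulrn ?powR_ge0// -powRrM mulVf ?powRr1//.
by rewrite pnatr_eq0 muln_eq0/= -lt0n.
Qed.

Let t0 k : (0 <= t k)%R.
Proof. by rewrite mulr_ge0// invr_ge0 exprn_ge0// ltW. Qed.

Lemma root_test_lty : (rho < r)%R -> \sum_(0 <= k <oo) (t k)%:E < +oo.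
Proof.
move=> rhor; have rho0 : (0 <= rho)%R.
  by apply: (cvgr_to_ge p_rho); apply: nearW => k; exact: powR_ge0.
pose q0 := ((rho + r) / 2)%R.
have [rq0 q0r] : (rho < q0)%R /\ (q0 < r)%R by rewrite /q0 !midf_lt.
have q0p : (0 < q0)%R by exact: le_lt_trans rq0.
pose q := ((q0 / r) ^+ 2)%R.
have qp : (0 < q)%R by rewrite exprn_gt0// divr_gt0.
have q1 : (q < 1)%R.
  have qr0 : (0 <= q0 / r)%R by rewrite divr_ge0// ltW.
  by rewrite /q expr_lt1// ltr_pdivrMr// mul1r.
have [N _ HN] := cvgr_lt rho p_rho _ rq0.
(* Chosen so that [t k <= C * q ^+ k] for all [k]: the sum takes care of [k <= N], the summand 1 of
   the rest. Indices above [N] are nonzero, so the dummy root at [k = 0] never matters there. *)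
pose C := (1 + \sum_(j < N.+1) t j / q ^+ j)%R.
have sum0 : (0 <= \sum_(j < N.+1) t j / q ^+ j)%R.
  by apply: sumr_ge0 => j _; rewrite divr_ge0// exprn_ge0// ltW.
have C0 : (0 <= C)%R by rewrite addr_ge0.
apply: (@le_lt_trans _ _ (C / (1 - q))%:E); last exact: ltry.
apply: le_trans (nneseries_geometric_le C0 _); last by rewrite (ltW qp) q1.
apply: lee_nneseries => [k _ _|k _]; first by rewrite lee_fin.
have qk : (0 < q ^+ k)%R by exact: exprn_gt0.
rewrite lee_fin -ler_pdivrMr//.
have [kN|Nk] := ltnP k N.+1.
  rewrite /C (bigD1 (Ordinal kN))//= addrCA lerDl addr_ge0//.
  by apply: sumr_ge0 => j _; rewrite divr_ge0// exprn_ge0// ltW.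
apply: (@le_trans _ _ 1%R); last by rewrite /C lerDl.
rewrite ler_pdivrMr// mul1r.
have k0 : (0 < k)%N by exact: leq_ltn_trans Nk.
have rk : (0 <= r ^- (2 * k))%R by rewrite invr_ge0 exprn_ge0// ltW.
rewrite /q -exprM expr_div_n mulrC ler_wpM2r// -(root_pow k0).
rewrite lerXn2r ?nnegrE ?powR_ge0 ?(ltW q0p)//; apply: ltW.
by apply: HN => /=; exact: ltnW.
Qed.

(** If [r < rho], all terms from some index on are at least 1, so the partial sums are unbounded. *)
Lemma root_test_le : \sum_(0 <= k <oo) (t k)%:E < +oo -> (rho <= r)%R.
Proof.
move=> fin; rewrite leNgt; apply/negP => rrho.
have [N _ HN] := cvgr_gt rho p_rho _ rrho.
have t1 k : (N < k)%N -> (1 <= t k)%R.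
  move=> Nk; have k0 : (0 < k)%N by exact: leq_ltn_trans Nk.
  rewrite mulrC ler_pdivlMr ?exprn_gt0// mul1r -(root_pow k0).
  rewrite lerXn2r ?nnegrE ?powR_ge0 ?(ltW r0)//; apply: ltW.
  by apply: HN => /=; exact: ltnW.
have part n : n%:R%:E <= \sum_(0 <= k < N.+1 + n) (t k)%:E.
  elim: n => [|n IH]; first by apply: sume_ge0 => k _; rewrite lee_fin.
  rewrite addnS big_nat_recr//= -natr1 EFinD leeD// lee_fin t1//.
  by rewrite ltnS leq_addr.
have tot n : n%:R%:E <= \sum_(0 <= k <oo) (t k)%:E.
  apply: (le_trans (part n)).
  by apply: nneseries_lim_ge => k _ _; rewrite lee_fin.
have G0 : 0 <= \sum_(0 <= k <oo) (t k)%:E := tot 0%N.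
set G := \sum_(0 <= k <oo) _ in fin tot G0 *.
have Gf : G \is a fin_num by rewrite ge0_fin_numE.
have := tot (Num.bound (fine G)); rewrite -(fineK Gf) lee_fin leNgt.
by rewrite archi_boundP// fine_ge0.
Qed.

End root_test.

Theorem theorem1p3 (K : realType) (d : measure_display) (X : measurableType d)
    (mu : probability X K) (R S1 S2 : set (X * X))
    (nu : probability (fg_type X) K)
    (rep : set (X -> X) -> X -> X) (rho1 rho2 : X -> K)
    (hX : standard_borel K X)
    (hR : discrete_pmp mu R) (hS2 : discrete_pmp mu S2) (hS1 : discrete_pmp mu S1)
    (hS2R : subrelation S2 R) (hS12 : subrelation S1 S2)
    (hnu : countably_supported mu R nu) (hsym : symmetric_law mu R nu)
    (hrep : representatives mu R rep) (hgen : generates mu R nu rep)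
    (hco : everywhere_coamenable mu S2 S1)
    (hrho1 : cospectral_radius mu R nu rep S1 rho1)
    (hrho2 : cospectral_radius mu R nu rep S2 rho2) :
  {ae mu, forall x, rho1 x = rho2 x}.
Proof.
have [B sepB] := standard_borel_separating hX.
have [D [g [enumD D0 _ _ _]]] :=
  walk_setup sepB hR hnu hsym hrep hgen (@negligible_set0 _ _ _ mu).
have mD := enum_measurable enumD.
have aeD : {ae mu, forall x, D x}.
  have : mu.-negligible (~` D) by apply/negligibleP => //; exact: measurableC.
  by [].
(* Restricting to pairs of rational radii leaves only countably many null sets. *)
pose P n x := if choice.unpickle n is Some (a, b) then
  (0 < ratr a :> K)%R -> (ratr a < ratr b :> K)%R ->
  green R S1 nu rep (ratr a) 0 x x < +oo -> green R S2 nu rep (ratr b) 0 x x < +oo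
  else True.
have aeP : {ae mu, forall x, forall n, P n x}.
  apply: ae_foralln => n; rewrite /P.
  case: choice.unpickle => [[a b]|]; last exact: aeW.
  have [a0|a0] := pselect (0 < ratr a :> K)%R; last by apply: aeW => x /a0.
  have [ab|ab] := pselect (ratr a < ratr b :> K)%R; last by apply: aeW => x _ /ab.
  have := green_transfer sepB hR hnu hsym hrep hgen hS2R hS12 hco a0 ab.
  by apply: filterS => x H _ _.
have aeDP : {ae mu, forall x, D x /\ forall n, P n x}.
  by move: aeD aeP; apply: filterS2 => x Dx Px.
move: hrho1 hrho2 aeDP; apply: filterS3 => x c1x c2x [Dx Px].
have hit_fin S k : S `<=` R -> return_prob R nu rep k x S \is a fin_num.
  move=> SR; rewrite ge0_fin_numE; last by apply: esum_ge0 => y _; exact: walk_ge0.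
  apply: le_lt_trans (ltry 1).
  apply: (@le_trans _ _ (\esum_(y in xsection R x) walk R nu rep k x y)).
    apply: le_esum_subset => [y _|y /xsectionP Sxy]; first exact: walk_ge0.
    by apply/xsectionP; exact: SR.
  apply: (walk_le1 (D := D)) => //; first by case: enumD.
    by move=> a b; exact: enum_invariant enumD a b.
  by move=> a _; exact: transition_le1.
have [_ _ S12] := hS12; have [_ _ S2R] := hS2R.
have S1R := subset_trans S12 S2R.
have p0 S k : (0 <= fine (return_prob R nu rep k x S))%R.
  by rewrite fine_ge0//; apply: esum_ge0 => y _; exact: walk_ge0.
have greenE S r : (0 < r)%R -> S `<=` R -> green R S nu rep r 0 x x =
    \sum_(0 <= k <oo) (r ^- (2 * k) * fine (return_prob R nu rep (2 * k) x S))%:E.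
  move=> r0 SR; rewrite /green -nneseries_esumT; last first.
    by move=> k; rewrite mule_ge0 ?hit_ge0// lee_fin invr_ge0 exprn_ge0// ltW.
  by apply: eq_eseriesr => k _; rewrite addn0 EFinM fineK// hit_fin.
apply/eqP; rewrite eq_le; apply/andP; split.
  (* The easy inequality: the [S1]-class is contained in the [S2]-class, so return probabilities can
     only increase. *)
  apply: (ler_cvg_to c1x c2x); apply: nearW => k.
  apply: ge0_ler_powR; rewrite ?nnegrE//.
  rewrite fine_le ?hit_fin//; apply: le_esum_subset => [y _|y /xsectionP Sxy].
    exact: walk_ge0.
  by apply/xsectionP; exact: S12.
rewrite leNgt; apply/negP => lt12.
have rho10 : (0 <= rho1 x)%R.
  by apply: (cvgr_to_ge c1x); apply: nearW => k; exact: powR_ge0.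
(* Rationals with [rho1 x < a < b < rho2 x]. The root test makes the Green function of [S1] finite
   at [a], so that of [S2] is finite at [b], which forces [rho2 x <= b]. *)
have [b] := rat_in_itvoo lt12; rewrite in_itv/= => /andP[r1b br2].
have [a] := rat_in_itvoo r1b; rewrite in_itv/= => /andP[r1a ab].
have a0 : (0 < ratr a :> K)%R by exact: le_lt_trans r1a.
have b0 := lt_trans a0 ab.
have := Px (choice.pickle (a, b)); rewrite /P choice.pickleK => /(_ a0 ab).
rewrite !greenE// => /(_ (root_test_lty (fun k => p0 S1 (2 * k)%N) a0 c1x r1a)).
move=> /(root_test_le (fun k => p0 S2 (2 * k)%N) b0 c2x).
by rewrite leNgt br2.
Qed.
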